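(* Suppose that for each $i\in\mathcal{J}$ there exist $A_i\subset B_i\subset\mathcal{J}$ such that $X_i$ is independent of $X_{A_i^c}$ and $X_{A_i}$ is independent of $X_{B_i^c}$. Let $N(B_i)=\{j\in\mathcal{J}: B_j\cap B_i\neq\varnothing\}$, let $Y_i=\sum_{j\in A_i}X_j$, let $2<p\leq 4$, and assume that $|N(B_i)|\leq\kappa$ for every $i\in\mathcal{J}$. Then $$\sup_{z\in\mathbb{R}} |F(z) - \Phi(z)| \leq (13 + 11\kappa) \sum_{i \in \mathcal{J}} (E|X_i|^{3 \wedge p} + E|Y_i|^{3 \wedge p}) + 2.5 \Big( \kappa \sum_{i \in \mathcal{J}} (E|X_i|^p + E|Y_i|^p) \Big)^{1/2}.$$ In particular, if $E|X_i|^p+E|Y_i|^p\leq\theta^p$ for some $\theta>0$ and for each $i\in\mathcal{J}$, then $$\sup_{z\in\mathbb{R}} |F(z) - \Phi(z)| \leq (13 + 11\kappa) n \theta^{3 \wedge p} + 2.5\, \theta^{p/2} \sqrt{\kappa n},\qquad n=|\mathcal{J}|.$$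
   Context: $\mathcal{J}$ is a finite index set of cardinality $n$ and $\{X_i, i\in\mathcal{J}\}$ is a family of real random variables on a common probability space with zero means and finite variances. $W=\sum_{i\in\mathcal{J}}X_i$, and it is assumed that $\mathrm{Var}(W)=1$. $F$ is the distribution function of $W$ and $\Phi$ is the standard normal distribution function. For $A\subset\mathcal{J}$, $X_A=\{X_i, i\in A\}$, $A^c=\mathcal{J}\setminus A$, and $|A|$ is the cardinality of $A$. $a\wedge b=\min(a,b)$. *)

(* Defs.v *)
From HB Require Import structures.
From mathcomp Require Import all_boot all_order all_algebra.
From mathcomp Require Import all_classical all_reals all_analysis.
(* Not exported by [all_analysis]; it makes {mfun T >-> R} a ring, so that sums
   of random variables are random variables. *)
From mathcomp Require Import measurable_realfun.

Set Implicit Arguments.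
Unset Strict Implicit.
Unset Printing Implicit Defensive.

Import Order.TTheory GRing.Theory Num.Theory.
Import numFieldNormedType.Exports.

Local Open Scope classical_set_scope.
Local Open Scope ring_scope.
Local Open Scope ereal_scope.

Section random_family.
Context {d : measure_display} {T : measurableType d} {R : realType}.
Context {P : probability T R} {J : finType}.
Implicit Types (X : J -> {RV P >-> R}) (A B : {set J}).

(* The sigma-algebra on [T] generated by X_A; trivial when [A] is empty. *)
Definition sigma_family X A : set (set T) :=
  <<s \bigcup_(i in [set` A]) preimage_set_system setT (X i) measurable >>.

Definition indep_subfamilies X A B : Prop :=
  forall E1 E2 : set T, sigma_family X A E1 -> sigma_family X B E2 ->
    P (E1 `&` E2) = P E1 * P E2.

Definition family_sum X A : {RV P >-> R} := (\sum_(i in A) X i)%R.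

End random_family.

Section moments_and_distance.
Context {d : measure_display} {T : measurableType d} {R : realType}.
Context {P : probability T R}.
Implicit Types W : {RV P >-> R}.

Definition abs_moment W (r : R) : \bar R := 'E_P[fun t => (`|W t| `^ r)%R].

Definition normal_cdf (z : R) : \bar R := normal_prob 0%R 1%R `]-oo, z].

Definition normal_distance W : \bar R :=
  ereal_sup [set `|cdf W z - normal_cdf z| | z in [set: R]].

End moments_and_distance.

Definition neighbours {J : finType} (B : J -> {set J}) (i : J) : {set J} :=
  [set j | B j :&: B i != finset.set0]%SET.

(* Main.v *)
Require Import Defs.
From HB Require Import structures.
From mathcomp Require Import all_boot all_order all_algebra.
From mathcomp Require Import all_classical all_reals all_analysis.
From mathcomp Require Import measurable_realfun.
From mathcomp Require Import ring lra.

Set Implicit Arguments.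
Unset Strict Implicit.

Import Order.TTheory GRing.Theory Num.Theory.
Import numFieldNormedType.Exports.

Local Open Scope classical_set_scope.
Local Open Scope ring_scope.

(** The proof is Stein's method with a self-improving estimate.

    Let delta be the Kolmogorov distance between W and the standard normal
    variable Z, and let h be the ramp equal to 1 left of z, to 0 right of
    z + al, and affine in between.  Since the normal density is at most 81/200,
    delta <= 81/200 al + sup_z |E h(W) - E h(Z)| ([kolmogorov_of_ramp]), so the
    expectation of a ramp has to be estimated for a well chosen width al.

    The solution f of Stein's equation f'(w) = w f(w) + h(w) - E h(Z) satisfies
    0 <= f <= 126/100 and |f'| <= 1, and w f(w) is nondecreasing.  Writing
    g = f', one has E h(W) - E h(Z) = E g(W) - E W f(W).  As X_i is orthogonal
    to every bounded function of W - Y_i, E W f(W) is the sum of the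
    E X_i (f(W) - f(W - Y_i)).  Truncating Y_i to [clip Y_i] in [-1, 1], the
    increment of f becomes the integral over t in [-1, 1[ of g(W + t) k(Y_i, t),
    where k is the kernel [kern].  Let Khat(t) be the sum of the X_i k(Y_i, t)
    and K(t) its mean.  As the E X_i Y_i sum to E W^2 = 1, the quantity to bound
    is, up to a truncation error ([stein_decomposition]), the integral of
      K(t) (E g(W) - E g(W + t)) - E g(W + t) (Khat(t) - K(t)).

    In the first term, g varies either through w f(w), which is locally
    Lipschitz, or through h, which varies only when W falls in a short interval;
    the probability of the latter is at most the normal one plus 2 delta.  So
    delta comes back, multiplied by a truncated third moment divided by al: with al a
    multiple of the moment sum, the factor is less than 1 and delta can be
    solved for ([rough_bound_solve], [fine_bound_solve]).

    In the second term, the variance of Khat(t) is at most kappa times the sum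
    of the second moments of its terms, because the terms of index i and j are
    uncorrelated as soon as B_i and B_j are disjoint ([local_variance_le]).  If
    p <= 3, the bound |g| <= 1 and a weighted Cauchy-Schwarz inequality are
    enough ([ramp_error_rough]).  If p >= 3, one first replaces g(W + t) by g(W),
    which makes the integral over t explicit and leaves the variance of the sum
    of the X_i [clip Y_i], controlled by p-th moments; the increments of g have
    a small second moment since w f(w) and h vary in opposite directions
    ([dstein_sqr_increment], [ramp_error_fine]).

    For p >= 3 the constants so obtained, 109/10 + 46/5 kappa, are better than
    13 + 11 kappa.  The slack pays for the passage from p-th to third moments in
    the second claim, where Young's inequality only gives
    E|X_i|^3 + E|Y_i|^3 <= 119/100 theta^3 ([cube_moments_le]). *)

(** * Monotonicity from derivatives, and rational bounds on pi *)

Section monotone.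
Variable R : realType.
Implicit Types (F dF : R -> R).

Lemma derive_le0_nincr F dF (a x y : R) :
  (forall t : R, is_derive t (1 : R) F (dF t)) -> (forall t, a <= t -> dF t <= 0) ->
  a <= x -> x <= y -> F y <= F x.
Proof.
move=> dFE dF0 ax; rewrite le_eqVlt => /predU1P[->//|xy].
have [|t] := @MVT R F dF x y xy (fun t _ => dFE t).
- apply: continuous_subspaceT => t.
  by apply: differentiable_continuous; apply/derivable1_diffP; case: (dFE t).
rewrite in_itv/= => /andP[xt ty] FE.
rewrite -subr_le0 FE mulr_le0_ge0 ?subr_ge0 ?(ltW xy)//.
by apply: dF0; rewrite (le_trans ax)// ltW.
Qed.

Lemma derive_ge0_ndecr F dF (a x y : R) :
  (forall t : R, is_derive t (1 : R) F (dF t)) -> (forall t, a <= t -> 0 <= dF t) ->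
  a <= x -> x <= y -> F x <= F y.
Proof.
move=> dFE dF0 ax xy; rewrite -lerN2.
apply: (@derive_le0_nincr (fun t => - F t) (fun t => - dF t) a) => //.
by move=> t at_; rewrite oppr_le0 dF0.
Qed.

End monotone.

Section pi_bounds.
Variable R : realType.

Lemma sin_le_id (x : R) : 0 <= x -> sin x <= x.
Proof.
move=> x0; rewrite -subr_le0.
have := @derive_le0_nincr R (fun t => sin t - t) (fun t => cos t - 1) 0 0 x.
rewrite sin0 subrr; by apply=> // t _; rewrite subr_le0 cos_le1.
Qed.

Lemma cos_half (x : R) : cos x = 1 - 2 * sin (x / 2) ^+ 2.
Proof.
rewrite [in LHS](splitr x) -mulr2n cos_mulr2n cos2sin2; ring.
Qed.

Lemma cos_ge_quad (x : R) : 0 <= x -> 1 - x ^+ 2 / 2 <= cos x.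
Proof.
move=> x0.
have := @derive_le0_nincr R (fun t => 1 - t ^+ 2 / 2 - cos t)
   (fun t => sin t - t) 0 0 x.
rewrite cos0 => H.
have : 1 - x ^+ 2 / 2 - cos x <= 1 - 0 ^+ 2 / 2 - 1.
  apply: H => //.
  - move=> t; apply: is_derive_eq => /=; by rewrite /GRing.scale/=; field.
  - by move=> t t0; rewrite subr_le0 sin_le_id.
lra.
Qed.

Lemma sin_ge_cubic (x : R) : 0 <= x -> x - x ^+ 3 / 6 <= sin x.
Proof.
move=> x0.
have := @derive_le0_nincr R (fun t => t - t ^+ 3 / 6 - sin t)
   (fun t => 1 - t ^+ 2 / 2 - cos t) 0 0 x.
rewrite sin0 => H.
have : x - x ^+ 3 / 6 - sin x <= 0 - 0 ^+ 3 / 6 - 0.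
  apply: H => //.
  - move=> t; apply: is_derive_eq => /=; by rewrite /GRing.scale/=; field.
  - by move=> t t0; rewrite subr_le0 cos_ge_quad.
lra.
Qed.

Lemma cos_double_ge (x y c c' : R) : y = x + x -> 0 <= c -> c <= cos x ->
  c' <= 2 * c ^+ 2 - 1 -> c' <= cos y.
Proof.
move=> -> c0 cx c'c; rewrite -mulr2n cos_mulr2n; apply: le_trans c'c _.
by rewrite lerD2r -[leRHS]mulr_natl ler_wpM2l// lerXn2r ?nnegrE// (le_trans c0).
Qed.

Lemma cos_double_le (x y c c' : R) : y = x + x -> 0 <= cos x -> cos x <= c ->
  2 * c ^+ 2 - 1 <= c' -> cos y <= c'.
Proof.
move=> -> c0 cx c'c; rewrite -mulr2n cos_mulr2n; apply: le_trans c'c.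
by rewrite lerD2r -[leLHS]mulr_natl ler_wpM2l// lerXn2r ?nnegrE// (le_trans c0).
Qed.

Lemma cos_le_sin_half (x y s : R) : x = y * 2 -> 0 <= s -> s <= sin y ->
  cos x <= 1 - 2 * s ^+ 2.
Proof.
move=> -> s0 sy; rewrite cos_half mulfK ?pnatr_eq0// lerD2l lerN2 ler_wpM2l//.
by rewrite lerXn2r ?nnegrE// (le_trans s0).
Qed.

(** The angle 61/40 is halved three times so that 1 - x^2/2 is sharp at 61/320;
    the rational bounds then propagate back through cos (2 x) = 2 cos^2 x - 1. *)
Lemma cos_61_40_gt0 : 0 < cos (61 / 40 : R).
Proof.
have c8 : 4909 / 5000 <= cos (61 / 320 : R).
  by have := @cos_ge_quad (61 / 320); lra.
have c4 : 927 / 1000 <= cos (61 / 160 : R).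
  by apply: (cos_double_ge _ _ c8); clear; lra.
have c2 : 718 / 1000 <= cos (61 / 80 : R).
  by apply: (cos_double_ge _ _ c4); clear; lra.
suff : 3 / 100 <= cos (61 / 40 : R) by clear; lra.
by apply: (cos_double_ge _ _ c2); clear; lra.
Qed.

(** Here an upper bound on the cosine is needed; it comes from
    cos x = 1 - 2 sin^2 (x/2) and the cubic lower bound on the sine. *)
Lemma cos_317_200_lt0 : cos (317 / 200 : R) < 0.
Proof.
have d2 : cos (317 / 800 : R) <= 577 / 625.
  have s1 : 49 / 250 <= sin (317 / 1600 : R).
    by have := @sin_ge_cubic (317 / 1600); lra.
  have /(_ (317 / 800)) := cos_le_sin_half _ _ s1.
  by move=> H; apply: le_trans (H _ _) _; clear; lra.
have d1 : cos (317 / 400 : R) <= 141 / 200.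
  apply: (cos_double_le _ _ d2); [by clear; lra| |by clear; lra].
  by have := @cos_ge_quad (317 / 800); clear; lra.
suff : cos (317 / 200 : R) <= - (1 / 200) by clear; lra.
apply: (cos_double_le _ _ d1); [by clear; lra| |by clear; lra].
by have := @cos_ge_quad (317 / 400); clear; lra.
Qed.

(** These bounds are what makes 81/200 an upper bound of 1 / sqrt (2 pi) and
    126/100 an upper bound of sqrt (pi / 2). *)
Lemma pi_bounds : 61 / 20 <= pi :> R /\ pi <= 317 / 100 :> R.
Proof.
have /andP[p1 p2] := pihalf_02 R; have p3 := pihalf_ge1 R.
split; rewrite leNgt; apply/negP => H.
- have := @ltr_cos R (pi / 2) (61 / 40).
  rewrite !in_itv/= cos_pihalf => E.
  have : cos (61 / 40 : R) < 0 by rewrite E; [lra|lra|lra].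
  by rewrite ltNge (ltW cos_61_40_gt0).
- have := @ltr_cos R (317 / 200) (pi / 2).
  rewrite !in_itv/= cos_pihalf => E.
  have : 0 < cos (317 / 200 : R) by rewrite E; [lra|lra|lra].
  by rewrite ltNge (ltW cos_317_200_lt0).
Qed.
End pi_bounds.

Lemma integrableZl_EFin d (T : measurableType d) (R : realType)
    (m : {measure set T -> \bar R}) (D : set T) (c : R) (f : T -> R) :
  measurable D -> m.-integrable D (EFin \o f) ->
  m.-integrable D (EFin \o (fun x => c * f x)).
Proof. by move=> mD intf; exact: (integrableZl mD c intf). Qed.

(** * The standard normal distribution *)

Section gauss.
Variable R : realType.
Local Notation mu := (@lebesgue_measure R).

Definition phi (x : R) : R := normal_pdf 0 1 x.

Lemma phiE x : phi x = normal_peak 1 * expR (- x ^+ 2 / 2).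
Proof.
rewrite /phi normal_pdfE ?oner_neq0// /normal_fun subr0 expr1n; congr (_ * expR (_ / _)).
Qed.

Lemma phi_gt0 x : 0 < phi x.
Proof. by rewrite phiE mulr_gt0 ?expR_gt0// normal_peak_gt0// oner_neq0. Qed.

Lemma phi_ge0 x : 0 <= phi x. Proof. exact: ltW (phi_gt0 x). Qed.

Lemma phi0 : phi 0 = normal_peak 1.
Proof. by rewrite phiE expr0n/= oppr0 mul0r expR0 mulr1. Qed.

Lemma phi_le_phi0 x : phi x <= phi 0.
Proof. by rewrite phi0; apply: normal_pdf_ub; rewrite oner_neq0. Qed.

Lemma phi0_le : phi 0 <= 81 / 200.
Proof.
rewrite phi0 /normal_peak; have [pil _] := pi_bounds R.
rewrite -[leRHS]invrK lef_pV2 ?posrE; last 2 first.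
- by rewrite sqrtr_gt0 expr1n mul1r; have := pi_gt0 R; lra.
- by rewrite invr_gt0; lra.
rewrite -[leLHS](@ger0_norm R) ?invr_ge0; last by lra.
by rewrite -sqrtr_sqr ler_sqrt ?expr1n ?mul1r; lra.
Qed.

Lemma phi0_ge : (126 / 50)^-1 <= phi 0.
Proof.
rewrite phi0 /normal_peak; have [_ piu] := pi_bounds R.
rewrite lef_pV2 ?posrE; last 2 first.
- by lra.
- by rewrite sqrtr_gt0 expr1n mul1r; have := pi_gt0 R; lra.
rewrite -[leRHS](@ger0_norm R); last by lra.
by rewrite -sqrtr_sqr ler_sqrt ?expr1n ?mul1r; have := pi_gt0 R; lra.
Qed.

Lemma phiN x : phi (- x) = phi x.
Proof. by rewrite !phiE sqrrN. Qed.

Global Instance is_derive_phi (x : R) : is_derive x (1 : R) phi (- x * phi x).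
Proof.
have -> : phi = (fun x => normal_peak 1 * expR (- x ^+ 2 / 2)).
  by apply/funext => t; rewrite phiE.
have h : is_derive x (1 : R) (expR \o (fun t : R => - t ^+ 2 / 2))
    (expR (- x ^+ 2 / 2) * - x).
  apply: is_derive1_comp; apply: is_derive_eq => /=.
  by rewrite /GRing.scale/=; field.
have -> : (fun x : R => normal_peak 1 * expR (- x ^+ 2 / 2)) =
    normal_peak 1 *: (expR \o (fun t : R => - t ^+ 2 / 2)) by [].
apply: is_derive_eq; rewrite /GRing.scale/=; ring.
Qed.

Lemma phi_continuous : continuous phi.
Proof. by apply: continuous_normal_pdf; rewrite oner_neq0. Qed.

Lemma phi_integrable : mu.-integrable setT (EFin \o phi).
Proof. exact: integrable_normal_pdf. Qed.

Lemma Rintegral_phi : \int[mu]_x phi x = 1.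
Proof. by rewrite /Rintegral integral_normal_pdf. Qed.

Lemma phi_integrableS (A : set R) : measurable A -> mu.-integrable A (EFin \o phi).
Proof. by move=> mA; apply: integrableS phi_integrable. Qed.

(** Real valued, so that it can be differentiated; [normal_cdfE] relates it to
    the extended real valued distribution function. *)
Definition Phi (w : R) : R := \int[mu]_(x in `]-oo, w]) phi x.

Lemma continuous_bounded_phi_integrable (h : R -> R) : continuous h ->
  (forall x, 0 <= h x <= 1) -> mu.-integrable setT (EFin \o (fun x => h x * phi x)).
Proof.
move=> ch h01.
have mh : measurable_fun setT h by exact: continuous_measurable_fun.
apply: (le_integrable _ _ _ phi_integrable) => //.
  apply/measurable_EFinP; apply: measurable_funM => //.
  exact: measurable_normal_pdf.
move=> x _; rewrite lee_fin normrM ler_piMl ?normr_ge0//.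
by have /andP[h0 h1] := h01 x; rewrite ger0_norm.
Qed.

Lemma is_derive_lower_integral (f : R -> R) (w : R) : continuous f ->
  mu.-integrable setT (EFin \o f) ->
  is_derive w (1 : R) (fun w => \int[mu]_(x in `]-oo, w]) f x) (f w).
Proof.
move=> cf intf.
(* Any right end beyond w would do. *)
have wu : w < w + 1 by rewrite ltrDl.
have [] := @continuous_FTC1 R f (BInfty _ true) w (w + 1) wu _ _ (cf w).
- exact: integrableS intf.
- exact: ltNyr.
by rewrite derive1E => df f'E; exact: DeriveDef df f'E.
Qed.

Lemma lower_upper (f : R -> R) (w : R) : mu.-integrable setT (EFin \o f) ->
  \int[mu]_(x in `]-oo, w]) f x + \int[mu]_(x in `]w, +oo[) f x = \int[mu]_x f x.
Proof.
move=> intf.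
have E : setT = `]-oo, w] `|` `]w, +oo[ :> set R.
  by rewrite -itv_bndbnd_setU// set_itvNyy.
rewrite [in RHS]E Rintegral_setU//.
- by rewrite -E.
- apply/disj_setPS => y [/=]; rewrite 2!in_itv/= andbT => yw.
  by rewrite ltNge yw.
Qed.

(* Phi is the distribution function of the identity under the normal law, which
   gives its limits at infinity. *)
Let idR : measurableTypeR R -> R := idfun.

#[local] HB.instance Definition _ :=
  @isMeasurableFun.Build _ _ _ _ idR (@measurable_id _ _ setT).

Lemma Phi_cvgy : Phi x @[x --> +oo] --> (1 : R).
Proof.
have := @cvg_cdfy1 _ _ _ _ (idR : {RV (normal_prob 0 1 : probability _ R) >-> R}).
by move=> /fine_cvg.
Qed.

Lemma Phi_cvgNy : Phi x @[x --> -oo] --> (0 : R).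
Proof.
have := @cvg_cdfNy0 _ _ _ _ (idR : {RV (normal_prob 0 1 : probability _ R) >-> R}).
by move=> /fine_cvg.
Qed.

Lemma is_derive_Phi (w : R) : is_derive w (1 : R) Phi (phi w).
Proof.
by apply: is_derive_lower_integral; [exact: phi_continuous|exact: phi_integrable].
Qed.

Lemma Phi_ge0 w : 0 <= Phi w.
Proof. by apply: Rintegral_ge0 => x _; exact: phi_ge0. Qed.

Lemma Phi_le1 w : Phi w <= 1.
Proof.
rewrite -Rintegral_phi -(lower_upper w phi_integrable) lerDl.
by apply: Rintegral_ge0 => x _; exact: phi_ge0.
Qed.

(** Phi(-t) + Phi(t) has derivative 0 by the evenness of the density, and tends
    to 1. *)
Lemma PhiN w : Phi (- w) = 1 - Phi w.
Proof.
have dF (t : R) : is_derive t (1 : R) (fun t => Phi (- t) + Phi t) 0.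
  have h1 := is_derive_Phi t.
  have h2 : is_derive t (1 : R) (Phi \o -%R) (phi (- t) * (- 1)).
    by apply: is_derive1_comp; exact: is_derive_Phi.
  by apply: is_derive_eq; rewrite phiN mulrN1 addNr.
have cst x : Phi (- x) + Phi x = Phi (- w) + Phi w.
  have := @is_derive_0_is_cst R (fun t => Phi (- t) + Phi t) x w dF.
  by [].
have cvgN : Phi (- x) @[x --> +oo] --> (0 : R).
  by have := Phi_cvgNy; rewrite cvgNy_compNP.
have : (Phi (- x) + Phi x) @[x --> +oo] --> (0 + 1 : R).
  exact: cvgD cvgN Phi_cvgy.
under eq_fun do rewrite cst.
move=> /(cvg_unique _ (cvg_cst _)) => /(_ _)/= E.
have := E (@Rhausdorff R); lra.
Qed.

(** D(t) = 1 - Phi(t) - t phi(t) / (1 + t^2) is nonincreasing on the half-line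
    t >= 0 and tends to 0, hence is nonnegative there.  The monotonicity of w f(w)
    rests on this lower bound of the Mills ratio. *)
Lemma mills_lower w : 0 <= w -> w * phi w <= (1 + w ^+ 2) * (1 - Phi w).
Proof.
move=> w0.
pose D t : R := 1 - Phi t - t * phi t / (1 + t ^+ 2).
have pos t : 0 < 1 + t ^+ 2 :> R by rewrite ltr_pwDl// sqr_ge0.
have dD (t : R) : is_derive t (1 : R) D (- 2 * phi t / (1 + t ^+ 2) ^+ 2).
  have h1 := is_derive_Phi t.
  have h3 : is_derive t (1 : R) (fun t : R => (1 + t ^+ 2)^-1)
      (- (1 + t ^+ 2) ^- 2 * (2 * t)).
    apply: is_deriveV; first by rewrite gt_eqF.
    by apply: is_derive_eq; rewrite /GRing.scale/=; ring.
  rewrite /D; apply: is_derive_eq; rewrite /GRing.scale/=.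
  by field; rewrite gt_eqF.
have D0 : 0 <= D w.
  rewrite leNgt; apply/negP => Dw.
  (* Far enough for t phi(t) / (1 + t^2) <= 1 / t to be smaller than - D(w). *)
  pose x := w - (D w)^-1 + 1.
  have iD : 0 < - (D w)^-1 by rewrite oppr_gt0 invr_lt0.
  have x0 : 0 < x by rewrite /x; lra.
  have : D x <= D w.
    apply: (derive_le0_nincr dD _ w0); last by rewrite /x; lra.
    move=> t t0; rewrite mulNr mulNr oppr_le0.
    by rewrite mulr_ge0// ?mulr_ge0 ?phi_ge0// invr_ge0 sqr_ge0.
  have : x * phi x / (1 + x ^+ 2) <= x^-1.
    rewrite ler_pdivrMr// ler_pdivlMl// mulrA -expr2.
    have x2 : 0 <= x ^+ 2 by rewrite sqr_ge0.
    have p0 := phi0_le; have px := phi_le_phi0 x; have p := phi_ge0 x.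
    by apply: (@le_trans _ _ (x ^+ 2 * 1)); [rewrite ler_wpM2l//; lra|lra].
  have : x^-1 < - D w.
    rewrite invf_plt ?posrE ?oppr_gt0// invrN /x; lra.
  have := Phi_le1 x; rewrite /D; lra.
move: D0; rewrite /D subr_ge0 ler_pdivrMr// => ?.
by rewrite [leRHS]mulrC.
Qed.

(** For t >= w the function phi(t) - w (1 - Phi(t)) is nonincreasing, and its
    limit is 0. *)
Lemma mills_upper w : 0 <= w -> w * (1 - Phi w) <= phi w.
Proof.
move=> w0; rewrite leNgt; apply/negP => wphi.
pose D t : R := phi t - w * (1 - Phi t).
have dD (t : R) : is_derive t (1 : R) D ((w - t) * phi t).
  have h1 := is_derive_Phi t.
  by rewrite /D; apply: is_derive_eq; rewrite /GRing.scale/=; ring.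
have Dw : D w < 0 by rewrite /D; lra.
have cR : w * (1 - Phi x) @[x --> +oo] --> (w * (1 - 1) : R).
  by apply: cvgMr; apply: cvgB; [exact: cvg_cst|exact: Phi_cvgy].
rewrite subrr mulr0 in cR.
near (pinfty_nbhs R) => x.
have : D x <= D w.
  apply: (derive_le0_nincr dD _ (lexx w));
    last by near: x; apply: nbhs_pinfty_ge; exact: num_real.
  by move=> t wt; rewrite mulr_le0_ge0 ?phi_ge0// subr_le0.
have : w * (1 - Phi x) < - D w.
  near: x; apply: cvgr_lt cR _ _; lra.
by have := phi_ge0 x; rewrite /D; lra.
Unshelve. all: by end_near. Qed.

Lemma Phi_0 : Phi 0 = 1 / 2.
Proof. by have := PhiN 0; rewrite oppr0; lra. Qed.

(** The Mills ratio decreases, by [mills_upper], so it is at most its value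
    sqrt (pi / 2) at the origin. *)
Lemma mills_max w : 0 <= w -> 1 - Phi w <= 126 / 100 * phi w.
Proof.
move=> w0.
pose E t : R := (1 - Phi t) / phi t.
have dE (t : R) : is_derive t (1 : R) E (t * (1 - Phi t) / phi t - 1).
  have h1 := is_derive_Phi t.
  have h3 : is_derive t (1 : R) (fun t : R => (phi t)^-1)
      (- (phi t) ^- 2 * (- t * phi t)).
    by apply: is_deriveV; rewrite gt_eqF// phi_gt0.
  rewrite /E; apply: is_derive_eq; rewrite /GRing.scale/=.
  by field; rewrite gt_eqF// phi_gt0.
have : E w <= E 0.
  apply: (derive_le0_nincr dE _ (lexx 0)) => // t t0.
  by rewrite subr_le0 ler_pdivrMr ?phi_gt0// mul1r mills_upper.
rewrite /E Phi_0 => H.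
have : E 0 <= 126 / 100.
  rewrite /E Phi_0 ler_pdivrMr ?phi_gt0//.
  have : 0 < phi 0 by exact: phi_gt0.
  have := phi0_ge; lra.
rewrite /E Phi_0 => H'.
by rewrite -ler_pdivrMr ?phi_gt0//; apply: le_trans H'; lra.
Qed.

End gauss.

(** * Stein's equation for a nonincreasing test function *)

Section stein.
Variable R : realType.
Local Notation mu := (@lebesgue_measure R).
Local Notation phi := (@phi R).
Local Notation Phi := (@Phi R).
Variable h : R -> R.
Hypothesis ch : continuous h.
Hypothesis h01 : forall x, 0 <= h x <= 1.
Hypothesis hn : forall x y, x <= y -> h y <= h x.

Let hphi x := h x * phi x.

Definition normal_mean := \int[mu]_x hphi x.
Local Notation N := normal_mean.
Definition lower_mean w := \int[mu]_(x in `]-oo, w]) hphi x.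
Local Notation A := lower_mean.
Definition stein w := (A w - N * Phi w) / phi w.
Local Notation f := stein.

Let hphi_int : mu.-integrable setT (EFin \o hphi).
Proof. exact: continuous_bounded_phi_integrable. Qed.

Let hphi_intS (D : set R) : measurable D -> mu.-integrable D (EFin \o hphi).
Proof. by move=> mD; apply: integrableS hphi_int. Qed.

Let hphi_cont : continuous hphi.
Proof. by move=> x; apply: cvgM; [exact: ch|exact: phi_continuous]. Qed.

Global Instance is_derive_lower_mean (w : R) : is_derive w (1 : R) A (h w * phi w).
Proof. exact: is_derive_lower_integral. Qed.

Lemma stein_equation (w : R) : is_derive w (1 : R) f (w * f w + (h w - N)).
Proof.
have h1 := is_derive_Phi w.
have h3 : is_derive w (1 : R) (fun t : R => (phi t)^-1)
    (- (phi w) ^- 2 * (- w * phi w)).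
  by apply: is_deriveV; rewrite gt_eqF// phi_gt0.
rewrite /f; apply: is_derive_eq; rewrite /GRing.scale/= /f.
by field; rewrite gt_eqF// phi_gt0.
Qed.

Let B w := \int[mu]_(x in `]w, +oo[) hphi x.

Let AB w : A w + B w = N.
Proof. exact: lower_upper. Qed.

Lemma upper_Phi w : \int[mu]_(x in `]w, +oo[) phi x = 1 - Phi w.
Proof. by rewrite -Rintegral_phi -(lower_upper w (@phi_integrable R)) addrC addKr. Qed.

Let A_ge w : h w * Phi w <= A w.
Proof.
rewrite -RintegralZl//; last exact: phi_integrableS.
apply: le_Rintegral => //.
- by apply: integrableZl_EFin => //; exact: phi_integrableS.
- exact: hphi_intS.
- by move=> x /=; rewrite in_itv/= => xw; rewrite ler_wpM2r ?phi_ge0 ?hn.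
Qed.

Let A_le w : A w <= Phi w.
Proof.
apply: le_Rintegral => //.
- exact: hphi_intS.
- exact: phi_integrableS.
- by move=> x _; rewrite ler_piMl ?phi_ge0//; have /andP[] := h01 x.
Qed.

Let B_le w : B w <= h w * (1 - Phi w).
Proof.
rewrite -upper_Phi -RintegralZl//; last exact: phi_integrableS.
apply: le_Rintegral => //.
- exact: hphi_intS.
- by apply: integrableZl_EFin => //; exact: phi_integrableS.
- move=> x /=; rewrite in_itv/= andbT => xw; rewrite ler_wpM2r ?phi_ge0 ?hn//.
  exact: ltW.
Qed.

Let B_ge0 w : 0 <= B w.
Proof.
apply: Rintegral_ge0 => x _; rewrite mulr_ge0 ?phi_ge0//; by have /andP[] := h01 x.
Qed.

Lemma normal_mean01 : 0 <= N <= 1.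
Proof.
apply/andP; split.
  by apply: Rintegral_ge0 => x _; rewrite mulr_ge0 ?phi_ge0//; have /andP[] := h01 x.
rewrite -(@Rintegral_phi R); apply: le_Rintegral => //.
- exact: phi_integrable.
- by move=> x _; rewrite ler_piMl ?phi_ge0//; have /andP[] := h01 x.
Qed.

Let fphi w : f w * phi w = A w - N * Phi w.
Proof. by rewrite /f divfK// gt_eqF// phi_gt0. Qed.

Let AE w : A w = N - B w. Proof. by rewrite -(AB w) addrK. Qed.

(* One of the two tails at w is the one to which [mills_max] applies. *)
Let mills_side w : Phi w <= 126 / 100 * phi w \/ 1 - Phi w <= 126 / 100 * phi w.
Proof.
have [w0|w0] := leP 0 w; [right|left]; first exact: mills_max.
have := @mills_max _ (- w); rewrite PhiN phiN subKr; apply.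
by rewrite oppr_ge0 ltW.
Qed.

(** With A and B the integrals of h phi over the two sides of w, f phi equals
    A (1 - Phi) - B Phi; as h is nonincreasing, A >= h(w) Phi and
    B <= h(w) (1 - Phi). *)
Lemma stein_ge0 w : 0 <= f w.
Proof.
rewrite -(pmulr_lge0 _ (phi_gt0 w)) fphi -(AB w).
have := A_ge w; have := B_le w; have := Phi_ge0 w; have := Phi_le1 w.
set a := A w; set b := B w; set F := Phi w; set k := h w => F1 F0 bk ak.
have : 0 <= (a - k * F) * (1 - F) by rewrite mulr_ge0 ?subr_ge0.
have : 0 <= (k * (1 - F) - b) * F by rewrite mulr_ge0 ?subr_ge0.
lra.
Qed.

(** f phi equals A - N Phi <= (1 - N) Phi as well as
    N (1 - Phi) - B <= N (1 - Phi); the bound follows on the side of the smaller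
    tail. *)
Lemma stein_le w : f w <= 126 / 100.
Proof.
rewrite -(ler_pM2r (phi_gt0 w)) fphi.
have /andP[N0 N1] := normal_mean01; have F0 := Phi_ge0 w; have F1 := Phi_le1 w.
have [Fl|Fu] := mills_side w.
  have : (1 - N) * Phi w <= 1 * Phi w by rewrite ler_wpM2r//; lra.
  by have := A_le w; lra.
have : N * (1 - Phi w) <= 1 * (1 - Phi w) by rewrite ler_wpM2r//; lra.
by rewrite AE; have := B_ge0 w; lra.
Qed.

(** This bound and [mul_stein_le] sandwich w f(w) between N - 1 and N, which is
    exactly what confines the derivative w f(w) + h(w) - N to [-1, 1]. *)
Lemma mul_stein_ge w : N - 1 <= w * f w.
Proof.
have /andP[N0 N1] := normal_mean01.
have [w0|w0] := leP 0 w.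
  by apply: (@le_trans _ _ 0); [lra|rewrite mulr_ge0// stein_ge0].
rewrite -(ler_pM2r (phi_gt0 w)) -mulrA fphi.
have M := @mills_upper _ (- w); rewrite PhiN phiN subKr in M.
have {}M := M _; have w1 : 0 <= - w by lra.
have : (1 - N) * (- w * Phi w) <= (1 - N) * phi w.
  by rewrite ler_wpM2l; [by []|lra|exact: M].
have : - w * A w <= - w * Phi w by rewrite ler_wpM2l// A_le.
lra.
Qed.

Lemma mul_stein_le w : w * f w <= N.
Proof.
have /andP[N0 N1] := normal_mean01.
have [w0|w0] := leP w 0.
  by apply: (@le_trans _ _ 0); [rewrite mulr_le0_ge0// stein_ge0|].
rewrite -(ler_pM2r (phi_gt0 w)) -mulrA fphi AE.
have M := mills_upper (ltW w0).
have : N * (w * (1 - Phi w)) <= N * phi w by rewrite ler_wpM2l.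
have : 0 <= w * B w by rewrite mulr_ge0 ?(ltW w0).
lra.
Qed.

(** The derivative of w f(w), times the density, is
    (1 + w^2) f phi + w phi (h - N).  Only the second term can be negative, and
    then [mills_lower] on the relevant side makes the first one prevail, because
    f phi >= (N - h) (1 - Phi) and f phi >= (h - N) Phi. *)
Lemma mul_stein_nondecreasing x y : x <= y -> x * f x <= y * f y.
Proof.
apply: (@derive_ge0_ndecr R (fun w => w * f w)
  (fun w => f w + w * (w * f w + (h w - N))) x x y _ _ (lexx x)) => t.
  have h1 := stein_equation t.
  by apply: is_derive_eq; rewrite /GRing.scale/=; ring.
move=> _; rewrite -(pmulr_lge0 _ (phi_gt0 t)).
rewrite (_ : _ * _ = (1 + t ^+ 2) * (f t * phi t) + t * phi t * (h t - N));
  last by ring.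
have f0 : 0 <= f t * phi t by rewrite mulr_ge0 ?stein_ge0 ?phi_ge0.
have p0 := phi_ge0 t.
have t2 : 0 <= t ^+ 2 by exact: sqr_ge0.
have [t0|t0] := leP 0 t.
  have [hN|hN] := leP N (h t).
    apply: addr_ge0; first by apply: mulr_ge0; [lra|].
    by apply: mulr_ge0; [exact: mulr_ge0|rewrite subr_ge0].
  have : (N - h t) * (t * phi t) <= (N - h t) * ((1 + t ^+ 2) * (1 - Phi t)).
    by rewrite ler_wpM2l ?mills_lower// subr_ge0 ltW.
  have : (1 + t ^+ 2) * ((N - h t) * (1 - Phi t)) <= (1 + t ^+ 2) * (f t * phi t).
    apply: ler_wpM2l; first lra.
    by rewrite fphi AE; have := B_le t; lra.
  lra.
have [hN|hN] := leP (h t) N.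
  apply: addr_ge0; first by apply: mulr_ge0; [lra|].
  rewrite -mulrA mulr_le0//; first exact: ltW.
  by rewrite mulr_ge0_le0// subr_le0.
have M := @mills_lower _ (- t); rewrite PhiN phiN subKr sqrrN in M.
have {}M : - t * phi t <= (1 + t ^+ 2) * Phi t by apply: M; lra.
have : (h t - N) * (- t * phi t) <= (h t - N) * ((1 + t ^+ 2) * Phi t).
  by rewrite ler_wpM2l// subr_ge0 ltW.
have : (1 + t ^+ 2) * ((h t - N) * Phi t) <= (1 + t ^+ 2) * (f t * phi t).
  apply: ler_wpM2l; first lra.
  by rewrite fphi; have := A_ge t; lra.
lra.
Qed.

Definition dstein w := w * f w + (h w - N).

Lemma dstein_norm_le1 w : `|dstein w| <= 1.
Proof.
have := mul_stein_ge w; have := mul_stein_le w; have /andP[? ?] := h01 w.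
by rewrite /dstein ler_norml => ? ?; apply/andP; split; lra.
Qed.

Lemma stein_continuous : continuous f.
Proof.
move=> w; apply: differentiable_continuous; apply/derivable1_diffP.
by case: (stein_equation w).
Qed.

Lemma dstein_continuous : continuous dstein.
Proof.
move=> w; apply: cvgD; first by apply: cvgM; [exact: cvg_id|exact: stein_continuous].
by apply: cvgB; [exact: ch|exact: cvg_cst].
Qed.

Lemma stein_lipschitz x y : `|f x - f y| <= `|x - y|.
Proof.
wlog xy : x y / x <= y.
  move=> H; have [|/ltW] := leP x y; first exact: H.
  by move=> yx; rewrite distrC (distrC x); exact: H.
rewrite distrC (distrC x) (ger0_norm (_ : 0 <= y - x)) ?subr_ge0//.
rewrite ler_norml; apply/andP; split.
  have : f x + x <= f y + y.
    apply: (@derive_ge0_ndecr R (fun w => f w + w) (fun w => dstein w + 1) x x y _ _ (lexx x) xy) => t.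
      by have h1 := stein_equation t; apply: is_derive_eq.
    by move=> _; have := dstein_norm_le1 t; rewrite ler_norml => /andP[]; lra.
  lra.
have : f y - y <= f x - x.
  apply: (@derive_le0_nincr R (fun w => f w - w) (fun w => dstein w - 1) x x y _ _ (lexx x) xy) => t.
    by have h1 := stein_equation t; apply: is_derive_eq.
  by move=> _; have := dstein_norm_le1 t; rewrite ler_norml => /andP[]; lra.
lra.
Qed.

(** From the splitting w (f(w + t) - f(w)) + t f(w + t). *)
Lemma mul_stein_lipschitz w t :
  `|(w + t) * f (w + t) - w * f w| <= `|t| * (`|w| + 126 / 100).
Proof.
rewrite (_ : _ - _ = w * (f (w + t) - f w) + t * f (w + t)); last by ring.
rewrite [leRHS]mulrDr; apply: le_trans (ler_normD _ _) _.
rewrite (normrM w) (normrM t) lerD//.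
  rewrite [leRHS]mulrC ler_wpM2l//.
  by rewrite (le_trans (stein_lipschitz _ _))// addrAC subrr add0r.
by rewrite ler_wpM2l// ger0_norm ?stein_ge0// stein_le.
Qed.

(** The two parts w f(w) and h(w) of the derivative vary in opposite directions,
    so the cross term of the square is nonpositive. *)
Lemma dstein_sqr_increment x y :
  (dstein y - dstein x) ^+ 2 <=
  (y * f y - x * f x) ^+ 2 + (h y - h x) ^+ 2.
Proof.
suff : (y * f y - x * f x) * (h y - h x) <= 0.
  by rewrite /dstein; set a := y * f y; set b := x * f x; nra.
have [xy|/ltW yx] := leP x y.
  by rewrite mulr_ge0_le0// ?subr_ge0 ?mul_stein_nondecreasing// subr_le0 hn.
by rewrite mulr_le0_ge0// ?subr_ge0 ?hn// subr_le0 mul_stein_nondecreasing.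
Qed.

End stein.

(** * Ramps between the indicators of two half-lines *)

Section ramp.
Variable R : realType.
Local Notation mu := (@lebesgue_measure R).
Variables (z al : R).
Hypothesis al0 : 0 < al.

Definition ramp (x : R) : R := Num.max 0 (Num.min 1 ((z + al - x) / al)).

Lemma ramp01 x : 0 <= ramp x <= 1.
Proof. by rewrite /ramp le_max lexx/= ge_max ler01/= ge_min lexx. Qed.

Lemma ramp_nonincreasing x y : x <= y -> ramp y <= ramp x.
Proof.
move=> xy; rewrite /ramp ge_max !le_max lexx/= le_min !ge_min lexx/=.
by rewrite ler_pM2r ?invr_gt0// lerD2l lerN2 xy !orbT.
Qed.

Lemma ramp_left x : x <= z -> ramp x = 1.
Proof.
move=> xz; rewrite /ramp min_l; first by rewrite max_r.
by rewrite ler_pdivlMr//; lra.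
Qed.

Lemma ramp_right x : z + al <= x -> ramp x = 0.
Proof.
move=> xz; rewrite /ramp max_l// ge_min; apply/orP; right.
by rewrite pmulr_lle0 ?invr_gt0//; lra.
Qed.

Lemma ramp_continuous : continuous ramp.
Proof.
move=> x; apply: (@continuous_max R R^o (cst 0) _ x); first exact: cvg_cst.
apply: (@continuous_min R R^o (cst 1) _ x); first exact: cvg_cst.
apply: cvgM; last exact: cvg_cst.
by apply: cvgB; [exact: cvg_cst|exact: cvg_id].
Qed.

Lemma ramp_lipschitz x y : `|ramp x - ramp y| <= `|x - y| / al.
Proof.
wlog xy : x y / x <= y.
  move=> H; have [|/ltW] := leP x y; first exact: H.
  by move=> yx; rewrite distrC (distrC x); exact: H.
rewrite (distrC x) (ger0_norm (_ : 0 <= y - x)) ?subr_ge0//.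
rewrite ger0_norm ?subr_ge0 ?ramp_nonincreasing//.
have xyal : 0 <= (y - x) / al by rewrite divr_ge0 ?(ltW al0)// subr_ge0.
have E : (z + al - x) / al = (z + al - y) / al + (y - x) / al by ring.
rewrite lerBlDr /ramp E; set p := (z + al - y) / al; set q := (y - x) / al.
have m0 : 0 <= Num.max 0 (Num.min 1 p) by rewrite le_max lexx.
have m1 : Num.min 1 p <= Num.max 0 (Num.min 1 p) by rewrite le_max lexx orbT.
rewrite ge_max; apply/andP; split; first by rewrite /q; lra.
apply: (@le_trans _ _ (q + Num.min 1 p)); last by rewrite lerD2l.
rewrite addr_minr le_min !ge_min (addrC p) lexx orbT andbT.
by rewrite lerDr xyal.
Qed.

(** A ramp can change between w and w + t only if the interval between these two
    points meets [z, z + al]; the shape of the bounds covers both signs of t. *)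
Lemma ramp_increment_support w t : ramp w != ramp (w + t) ->
  z - Num.max t 0 < w <= z + al + Num.max (- t) 0.
Proof.
apply: contraR; rewrite negb_and -leNgt -ltNge => /orP[].
  rewrite lerBrDr => wz; apply/eqP; rewrite !ramp_left//.
    by apply: le_trans wz; rewrite lerD2l le_max lexx.
  by apply: le_trans wz; rewrite lerDl le_max lexx orbT.
move=> /ltW zw; apply/eqP; rewrite !ramp_right//.
  have : - t <= Num.max (- t) 0 by rewrite le_max lexx.
  by move: zw; clear; lra.
by apply: le_trans zw; rewrite lerDl le_max lexx orbT.
Qed.

Lemma Phi_increment (a b : R) : a <= b -> Phi b - Phi a <= 81 / 200 * (b - a).
Proof.
have : forall t, phi t <= 81 / 200 :> R.
  by move=> t; apply: le_trans (phi_le_phi0 t) (phi0_le R).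
move: (81 / 200) => c phic ab; suff : Phi b - c * b <= Phi a - c * a by lra.
have dF (t : R) : is_derive t (1 : R) (fun w => Phi w - c * w) (phi t - c).
  have h := is_derive_Phi t; apply: is_derive_eq; rewrite /GRing.scale/=; ring.
apply: (derive_le0_nincr dF _ (lexx a) ab) => t _.
by rewrite subr_le0.
Qed.

Lemma normal_mean_ramp_ge : Phi z <= normal_mean ramp.
Proof.
have i := continuous_bounded_phi_integrable ramp_continuous ramp01.
rewrite /normal_mean -(lower_upper z i) -[leLHS]addr0 lerD//; last first.
  by apply: Rintegral_ge0 => x _; rewrite mulr_ge0 ?phi_ge0//; have /andP[] := ramp01 x.
apply: le_Rintegral => //.
- exact: phi_integrableS.
- exact: integrableS i.
- by move=> x /=; rewrite in_itv/= => xz; rewrite ramp_left// mul1r.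
Qed.

Lemma normal_mean_ramp_le : normal_mean ramp <= Phi (z + al).
Proof.
have i := continuous_bounded_phi_integrable ramp_continuous ramp01.
rewrite /normal_mean -(lower_upper (z + al) i) -[leRHS]addr0 lerD//.
  apply: le_Rintegral => //.
  - exact: integrableS i.
  - exact: phi_integrableS.
  - by move=> x _; rewrite ler_piMl ?phi_ge0//; have /andP[] := ramp01 x.
rewrite (@eq_Rintegral _ _ _ _ _ (fun=> 0)); first by rewrite Rintegral_cst// mul0r.
move=> x; rewrite inE/= in_itv/= andbT => /ltW zx.
by rewrite ramp_right// mul0r.
Qed.

End ramp.

(** * Integrable and square integrable random variables *)

Section expectation.
Context {d : measure_display} {T : measurableType d} {R : realType}.
Variable P : probability T R.
Implicit Types f g : T -> R.

Definition intg f := P.-integrable setT (EFin \o f).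

Lemma intg_measurable f : intg f -> measurable_fun setT f.
Proof. by move=> /measurable_int/measurable_EFinP. Qed.

Lemma intg_le f g : measurable_fun setT f -> intg g ->
  (forall t, `|f t| <= `|g t|) -> intg f.
Proof.
move=> mf ig fg; apply: le_integrable ig => //; first exact/measurable_EFinP.
by move=> t _; rewrite lee_fin.
Qed.

Lemma intg_cst (c : R) : intg (fun=> c).
Proof. exact: finite_measure_integrable_cst. Qed.

Lemma intgD f g : intg f -> intg g -> intg (fun t => f t + g t).
Proof. by move=> i1 i2; exact: (integrableD measurableT i1 i2). Qed.

Lemma intgB f g : intg f -> intg g -> intg (fun t => f t - g t).
Proof. by move=> i1 i2; exact: (integrableB measurableT i1 i2). Qed.

Lemma intgZ (c : R) f : intg f -> intg (fun t => c * f t).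
Proof. exact: integrableZl_EFin. Qed.

Lemma intg_norm f : intg f -> intg (fun t => `|f t|).
Proof. exact: integrable_norm. Qed.

Lemma intg_sum (I : Type) (s : seq I) (Q : pred I) (F : I -> T -> R) :
  (forall i, intg (F i)) -> intg (fun t => \sum_(i <- s | Q i) F i t).
Proof.
move=> iF; elim: s => [|i s IH].
  by under eq_fun do rewrite big_nil; exact: intg_cst.
under eq_fun do rewrite big_cons.
by case: (Q i) => //; apply: intgD.
Qed.

Lemma ED f g : intg f -> intg g ->
  \int[P]_t (f t + g t) = \int[P]_t f t + \int[P]_t g t.
Proof. exact: RintegralD. Qed.

Lemma EB f g : intg f -> intg g ->
  \int[P]_t (f t - g t) = \int[P]_t f t - \int[P]_t g t.
Proof. exact: RintegralB. Qed.

Lemma EZ (c : R) f : intg f -> \int[P]_t (c * f t) = c * \int[P]_t f t.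
Proof. exact: RintegralZl. Qed.

Lemma Ecst (c : R) : \int[P]_t c = c.
Proof. rewrite Rintegral_cst// -[RHS]mulr1; congr (_ * _).
by have /(congr1 fine) := @probability_setT _ _ _ P. Qed.

Lemma Esum (I : Type) (s : seq I) (Q : pred I) (F : I -> T -> R) :
  (forall i, intg (F i)) ->
  \int[P]_t (\sum_(i <- s | Q i) F i t) = \sum_(i <- s | Q i) \int[P]_t F i t.
Proof.
move=> iF; elim: s => [|i s IH].
  by rewrite big_nil -[RHS]Ecst; apply: eq_Rintegral => t _; rewrite big_nil.
rewrite big_cons -IH; under eq_Rintegral do rewrite big_cons.
by case: (Q i) => //; rewrite ED//; exact: intg_sum.
Qed.

Lemma Ele f g : intg f -> intg g -> (forall t, f t <= g t) ->
  \int[P]_t f t <= \int[P]_t g t.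
Proof. by move=> i1 i2 fg; apply: le_Rintegral => // t _; exact: fg. Qed.

Lemma Enorm f : intg f -> `|\int[P]_t f t| <= \int[P]_t `|f t|.
Proof. exact: le_normr_Rintegral. Qed.

Lemma Enorm_le f g : intg f -> intg g -> (forall t, `|f t| <= g t) ->
  `|\int[P]_t f t| <= \int[P]_t g t.
Proof.
move=> i1 i2 fg; apply: le_trans (Enorm i1) _.
by apply: Ele => //; exact: intg_norm.
Qed.

(** Square integrability is the right class here: it is stable under products
    with bounded functions, and products of two members are integrable. *)
Definition sqint f := measurable_fun setT f /\ intg (fun t => f t ^+ 2).

Lemma sqint_measurable f : sqint f -> measurable_fun setT f. Proof. by case. Qed.

Lemma sqintM f g : sqint f -> sqint g -> intg (fun t => f t * g t).
Proof.
move=> [mf f2] [mg g2].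
apply: (@intg_le _ (fun t => f t ^+ 2 + g t ^+ 2)).
- exact: measurable_funM.
- exact: intgD.
- move=> t; rewrite [leRHS]ger0_norm ?addr_ge0 ?sqr_ge0//.
  have a := sqr_ge0 (f t + g t); have b := sqr_ge0 (f t - g t).
  by rewrite ler_norml; apply/andP; split; nra.
Qed.

Lemma sqint_cst (c : R) : sqint (fun=> c).
Proof. by split; [exact: measurable_cst|exact: intg_cst]. Qed.

Lemma sqint_intg f : sqint f -> intg f.
Proof.
move=> f2; have := sqintM f2 (sqint_cst 1).
by under eq_fun do rewrite mulr1.
Qed.

Lemma sqint_le f g : measurable_fun setT f -> sqint g ->
  (forall t, `|f t| <= `|g t|) -> sqint f.
Proof.
move=> mf [mg g2] fg; split => //; apply: intg_le g2 _.
  exact: measurable_funX.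
by move=> t; rewrite !normrX lerXn2r ?nnegrE.
Qed.

Lemma sqintD f g : sqint f -> sqint g -> sqint (fun t => f t + g t).
Proof.
move=> f2 g2; split.
  by apply: measurable_funD; apply: sqint_measurable.
have -> : (fun t => (f t + g t) ^+ 2) =
    (fun t => f t ^+ 2 + (f t * g t + (f t * g t + g t ^+ 2))).
  by apply/funext => t; ring.
apply: intgD; first by case: f2.
by apply: intgD; [exact: sqintM|apply: intgD; [exact: sqintM|case: g2]].
Qed.

Lemma sqintMb f g (C : R) : measurable_fun setT g -> (forall t, `|g t| <= C) ->
  sqint f -> sqint (fun t => f t * g t).
Proof.
move=> mg gC [mf f2]; split; first exact: measurable_funM.
apply: (@intg_le _ (fun t => C ^+ 2 * f t ^+ 2)).
- by apply: measurable_funX; exact: measurable_funM.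
- exact: intgZ.
- move=> t; rewrite exprMn [in leRHS]mulrC normrM [leRHS]normrM ler_wpM2l//.
  rewrite !normrX.
  by rewrite lerXn2r ?nnegrE// (le_trans (gC t))// ler_norm.
Qed.

Lemma sqintZ (c : R) f : sqint f -> sqint (fun t => c * f t).
Proof.
move=> f2; have := @sqintMb f (fun=> c) `|c| (@measurable_cst _ _ _ _ _ _) (fun=> lexx _) f2.
by under eq_fun do rewrite mulrC.
Qed.

Lemma sqintB f g : sqint f -> sqint g -> sqint (fun t => f t - g t).
Proof.
move=> f2 g2; have := sqintD f2 (sqintZ (-1) g2).
by under eq_fun do rewrite mulN1r.
Qed.

Lemma sqint_sum (I : Type) (s : seq I) (Q : pred I) (F : I -> T -> R) :
  (forall i, sqint (F i)) -> sqint (fun t => \sum_(i <- s | Q i) F i t).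
Proof.
move=> iF; elim: s => [|i s IH].
  by under eq_fun do rewrite big_nil; exact: sqint_cst.
under eq_fun do rewrite big_cons.
by case: (Q i) => //; apply: sqintD.
Qed.

Lemma sqint_norm f : sqint f -> sqint (fun t => `|f t|).
Proof.
move=> f2; apply: (sqint_le _ f2) => [|t]; last by rewrite normr_id.
by apply: measurableT_comp => //; exact: sqint_measurable.
Qed.

Lemma sqintMb_intg f g (C : R) : measurable_fun setT g -> (forall t, `|g t| <= C) ->
  sqint f -> intg (fun t => f t * g t).
Proof. by move=> mg gC f2; exact: sqint_intg (sqintMb mg gC f2). Qed.

Section independence.
Variables U V : T -> R.
Hypotheses (mU : measurable_fun setT U) (mV : measurable_fun setT V).
Hypothesis indUV : forall A B : set R, measurable A -> measurable B ->
  (P (U @^-1` A `&` V @^-1` B) = P (U @^-1` A) * P (V @^-1` B))%E.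

#[local] HB.instance Definition _ := isMeasurableFun.Build _ _ _ _ U mU.
#[local] HB.instance Definition _ := isMeasurableFun.Build _ _ _ _ V mV.

Let UV (t : T) : R * R := (U t, V t).

Let mUV : measurable_fun setT UV.
Proof. exact: measurable_fun_pair. Qed.

#[local] HB.instance Definition _ := isMeasurableFun.Build _ _ _ _ UV mUV.

Let PU : probability R R := distribution P (U : {mfun T >-> R}).
Let PV : probability R R := distribution P (V : {mfun T >-> R}).

Let PUV : probability (R * R)%type R :=
  distribution P (UV : {mfun T >-> (R * R)%type}).

Let joint A : measurable A -> (PU \x PV)%E A = PUV A.
Proof.
by move=> mA; apply: product_measure_unique => // B C mB mC; exact: indUV.
Qed.

(** Independence identifies the joint law of U and V with the product of their
    laws, and Fubini's theorem separates the variables. *)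
Lemma indep_E_mul : intg U -> intg V -> intg (fun t => U t * V t) ->
  \int[P]_t (U t * V t) = \int[P]_t U t * \int[P]_t V t.
Proof.
move=> iU iV iUV.
pose m (xy : R * R) : \bar R := (xy.1 * xy.2)%:E.
have mm : measurable_fun setT m.
  by apply/measurable_EFinP; apply: measurable_funM;
    [exact: measurable_fst|exact: measurable_snd].
have im : (PU \x PV)%E.-integrable setT m.
  apply/integrableP; split => //.
  rewrite (@eq_measure_integral _ _ _ _ PUV); last first.
    by move=> A mA _; exact: joint.
  rewrite ge0_integral_distribution//; last exact: measurableT_comp.
  by move/integrableP : iUV => [].
have E1 : (\int[PU \x PV]_xy m xy = \int[P]_t (U t * V t)%:E)%E.
  rewrite (@eq_measure_integral _ _ _ _ PUV); last first.
    by move=> A mA _; exact: joint.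
  by rewrite integral_distribution.
have EU : (\int[PU]_x x%:E = \int[P]_t (U t)%:E)%E.
  by rewrite integral_distribution.
have EV : (\int[PV]_x x%:E = \int[P]_t (V t)%:E)%E.
  by rewrite integral_distribution.
have iPV : PV.-integrable setT (EFin \o id).
  by apply: integrable_pushforward => //; exact/measurable_EFinP.
have iPU : PU.-integrable setT (EFin \o id).
  by apply: integrable_pushforward => //; exact/measurable_EFinP.
have E2 x : (\int[PV]_y m (x, y) = (x * \int[P]_t V t)%:E)%E.
  rewrite /m /=; under eq_integral do rewrite EFinM.
  by rewrite (integralZl _ iPV)// EV EFinM /Rintegral fineK// integrable_fin_num.
rewrite {1}/Rintegral -E1 -integral12_prod_meas1// /fubini_F.
under eq_integral do rewrite E2 mulrC EFinM.
rewrite (integralZl _ iPU)// EU fineM//.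
  by rewrite mulrC.
exact: integrable_fin_num.
Qed.

End independence.

(** Only the covariances of neighbours remain.  Each is bounded by the mean of
    two second moments of centred variables, and by symmetry of the relation
    every index is counted at most kappa times. *)
Lemma E_sqr_sum_local (J : finType) (nb : J -> {set J}) (kappa : R) (Z : J -> T -> R) :
  (forall i, sqint (Z i)) ->
  (forall i j, (j \in nb i) = (i \in nb j)) ->
  (forall i, #|nb i|%:R <= kappa) ->
  (forall i j, j \notin nb i ->
    \int[P]_t (Z i t * Z j t) = \int[P]_t Z i t * \int[P]_t Z j t) ->
  \int[P]_t ((\sum_i Z i t - \int[P]_t (\sum_i Z i t)) ^+ 2) <=
  kappa * \sum_i \int[P]_t (Z i t ^+ 2).
Proof.
move=> sZ nbs nbk cov0.
pose D i t := Z i t - \int[P]_t Z i t.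
have iZ i : intg (Z i) by exact: sqint_intg.
have sD i : sqint (D i) by apply: sqintB; [exact: sZ|exact: sqint_cst].
have iZZ i j : intg (fun t => Z i t * Z j t) by exact: sqintM.
have iDD i j : intg (fun t => D i t * D j t) by exact: sqintM.
have EDD i j : \int[P]_t (D i t * D j t) =
    \int[P]_t (Z i t * Z j t) - \int[P]_t Z i t * \int[P]_t Z j t.
  set a := \int[P]_t Z i t; set b := \int[P]_t Z j t.
  transitivity (\int[P]_t (Z i t * Z j t - (b * Z i t + (a * Z j t - a * b)))).
    by apply: eq_Rintegral => t _; rewrite /D -/a -/b; ring.
  rewrite EB ?ED ?EB ?EZ ?Ecst//.
  - by rewrite -/a -/b; ring.
  - exact: intgZ.
  - exact: intg_cst.
  - exact: intgZ.
  - by apply: intgB; [exact: intgZ|exact: intg_cst].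
  - by apply: intgD; [exact: intgZ|apply: intgB; [exact: intgZ|exact: intg_cst]].
have -> : \int[P]_t ((\sum_i Z i t - \int[P]_t (\sum_i Z i t)) ^+ 2) =
    \sum_i \sum_j \int[P]_t (D i t * D j t).
  have DE t : (\sum_i Z i t - \int[P]_t (\sum_i Z i t)) ^+ 2 =
      \sum_i \sum_j D i t * D j t.
    rewrite (@Esum J (index_enum J) xpredT Z iZ) -sumrB expr2 mulr_suml.
    by apply: eq_bigr => i _; rewrite mulr_sumr.
  under eq_Rintegral do rewrite DE.
  rewrite (@Esum J (index_enum J) xpredT (fun i t => \sum_j D i t * D j t)).
    apply: eq_bigr => i _.
    by rewrite (@Esum J (index_enum J) xpredT (fun j t => D i t * D j t)).
  by move=> i; apply: intg_sum.
have EDi i : \int[P]_t (D i t * D i t) <= \int[P]_t (Z i t ^+ 2).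
  rewrite EDD (@eq_Rintegral _ _ _ _ _ (fun t => Z i t ^+ 2)); last first.
    by move=> t _; rewrite expr2.
  by rewrite lerBlDr lerDl -expr2 sqr_ge0.
have EDj i j : \int[P]_t (D i t * D j t) <=
    (\int[P]_t (Z i t ^+ 2) + \int[P]_t (Z j t ^+ 2)) / 2.
  apply: (@le_trans _ _ (\int[P]_t (2^-1 * (D i t * D i t + D j t * D j t)))).
    apply: Ele => //; first by apply: intgZ; exact: intgD.
    by move=> t; have := sqr_ge0 (D i t - D j t); lra.
  rewrite EZ ?ED//; last exact: intgD.
  by rewrite mulrC ler_pM2r ?invr_gt0// lerD.
have nb0 i j : j \notin nb i -> \int[P]_t (D i t * D j t) = 0.
  by move=> ij; rewrite EDD cov0// subrr.
pose q i := \int[P]_t (Z i t ^+ 2).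
apply: (@le_trans _ _ (\sum_i \sum_(j in nb i) (q i + q j) / 2)).
  apply: ler_sum => i _; rewrite (bigID (mem (nb i)))/= -[leRHS]addr0 lerD//.
    by apply: ler_sum => j _; exact: EDj.
  by rewrite big1// => j; exact: nb0.
have -> : \sum_i \sum_(j in nb i) (q i + q j) / 2 = \sum_i \sum_(j in nb i) q i.
  have sw : \sum_i \sum_(j in nb i) q j = \sum_i \sum_(j in nb i) q i.
    rewrite (exchange_big_dep xpredT)//=; apply: eq_bigr => i _.
    by apply: eq_bigl => j; rewrite nbs.
  under eq_bigr do rewrite -mulr_suml big_split/=.
  by rewrite -mulr_suml big_split/= sw; field.
rewrite mulr_sumr; apply: ler_sum => i _.
rewrite sumr_const -[leLHS]mulr_natl ler_wpM2r//.
by apply: Rintegral_ge0 => t _; exact: sqr_ge0.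
Qed.

End expectation.

(** * Functions of a subfamily of the variables *)

Section sigma_families.
Context {d : measure_display} {T : measurableType d} {R : realType}.
Variable P : probability T R.
Context {J : finType}.
Variable X : J -> {RV P >-> R}.

Lemma family_sumE (A : {set J}) t : family_sum X A t = \sum_(i in A) X i t.
Proof.
exact: mfun_sum.
Qed.

Definition family_measurable (A : {set J}) (U : T -> R) :=
  forall B : set R, measurable B -> sigma_family X A (U @^-1` B).

(* The same sigma-algebra as a measurable space, so that the closure properties
   of measurable functions are available. *)
Let G (A : {set J}) := g_sigma_algebraType
  (\bigcup_(i in [set` A]) preimage_set_system setT (X i) measurable).

Let family_measurableE (A : {set J}) (U : T -> R) :
  measurable_fun setT (U : G A -> R) -> family_measurable A U.
Proof. by move=> mU B mB; have := mU measurableT B mB; rewrite setTI. Qed.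

Let mG (A : {set J}) i : i \in A -> measurable_fun setT (X i : G A -> R).
Proof.
move=> iA _ B mB; apply: sub_sigma_algebra; exists i => //.
by exists B.
Qed.

Lemma family_measurable_X (A : {set J}) i : i \in A -> family_measurable A (X i).
Proof. by move=> iA; apply: family_measurableE; exact: mG. Qed.

Let mGsum (A : {set J}) : measurable_fun setT (fun t : G A => \sum_(j in A) X j t).
Proof.
rewrite (_ : (fun t => _) =
    (fun t => \sum_j if j \in A then X j t else 0)); last first.
  by apply/funext => t; rewrite big_mkcond.
apply: measurable_sum => j; case: (boolP (j \in A)) => [jA|_]; first exact: mG.
exact: measurable_cst.
Qed.

Lemma family_measurable_comp2 (A : {set J}) i (g : R * R -> R) :
  i \in A -> measurable_fun setT g ->
  family_measurable A (fun t => g (X i t, \sum_(j in A) X j t)).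
Proof.
move=> iA mg; apply: family_measurableE.
apply: (@measurableT_comp _ _ _ _ _ _ g setT
  (fun t : G A => (X i t, \sum_(j in A) X j t))) => //.
by apply: measurable_fun_pair; [exact: mG|exact: mGsum].
Qed.

Lemma family_measurable_sum (A : {set J}) (g : R -> R) : measurable_fun setT g ->
  family_measurable A (fun t => g (\sum_(j in A) X j t)).
Proof.
move=> mg; apply: family_measurableE.
apply: (@measurableT_comp _ _ _ _ _ _ g setT
  (fun t : G A => \sum_(j in A) X j t)) => //.
Qed.

Lemma family_measurableS (A A' : {set J}) U : A \subset A' ->
  family_measurable A U -> family_measurable A' U.
Proof.
move=> AA' mU B mB; apply: sub_sigma_algebra2 (mU B mB).
by move=> E [i iA H]; exists i => //=; exact: (fintype.subsetP AA').
Qed.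

Lemma indep_subfamilies_E_mul (A A' : {set J}) (U V : T -> R) :
  indep_subfamilies X A A' ->
  measurable_fun setT U -> measurable_fun setT V ->
  family_measurable A U -> family_measurable A' V ->
  intg P U -> intg P V -> intg P (fun t => U t * V t) ->
  \int[P]_t (U t * V t) = \int[P]_t U t * \int[P]_t V t.
Proof.
move=> ind mU mV fU fV; apply: indep_E_mul => // B B' mB mB'.
by apply: ind; [exact: fU|exact: fV].
Qed.

End sigma_families.

(** * The kernel that represents increments *)

(** Half-open, like the intervals where the kernel does not vanish. *)
Definition window (R : realType) : set R := `[(-1)%R, 1%R[%classic.
Arguments window R : clear implicits.

Section kernel.
Variable R : realType.
Local Notation mu := (@lebesgue_measure R).

Definition clip (y : R) : R := Num.max (-1) (Num.min 1 y).

(** Signed indicator of the interval between - y and 0: the integral of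
    g(w + t) k(y, t) over t is an increment of a primitive of g from w - y to w. *)
Definition kern (y t : R) : R :=
  if (- y <= t) && (t < 0) then 1 else if (0 <= t) && (t < - y) then -1 else 0.

Lemma kern_norm_le1 y t : `|kern y t| <= 1.
Proof. by rewrite /kern; case: ifP => _; [|case: ifP => _]; rewrite ?normrN ?normr1 ?normr0. Qed.

Lemma kern_sqr y t : kern y t ^+ 2 = `|kern y t|.
Proof.
by rewrite /kern; case: ifP => _; [|case: ifP => _];
  rewrite ?sqrrN ?normrN ?normr1 ?normr0 ?expr1n ?expr0n.
Qed.

(** The sign of the kernel depends on y only, so integrals of |k| reduce to
    integrals of k. *)
Lemma kern_norm y t : `|kern y t| = (if 0 <= y then 1 else -1) * kern y t.
Proof.
rewrite /kern; case: ifPn => [/andP[yt t0]|_].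
  by rewrite (_ : 0 <= y) ?mul1r ?normr1//; lra.
case: ifPn => [/andP[t0 ty]|_]; last by rewrite mulr0 normr0.
by rewrite (_ : 0 <= y = false) ?mulN1r ?normrN ?normr1 ?opprK//; apply/negbTE; rewrite -ltNge; lra.
Qed.

Lemma kern_normM y t : `|t| * `|kern y t| = - (t * kern y t).
Proof.
rewrite /kern; case: ifPn => [/andP[yt t0]|_].
  by rewrite normr1 !mulr1 ltr0_norm.
case: ifPn => [/andP[t0 ty]|_]; last by rewrite mulr0 normr0 mulr0 oppr0.
by rewrite normrN normr1 mulr1 mulrN1 opprK ger0_norm.
Qed.

Lemma clip_norm_le1 y : `|clip y| <= 1.
Proof.
by rewrite ler_norml /clip le_max lexx/= ge_max ge_min lexx/=; apply/andP; split => //; lra.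
Qed.

Lemma measurable_kern : measurable_fun setT (fun p : R * R => kern p.1 p.2).
Proof.
have m1 : measurable_fun setT (fun p : R * R => - p.1).
  by apply: measurableT_comp => //; exact: measurable_fst.
have m2 : measurable_fun setT (fun p : R * R => p.2) by exact: measurable_snd.
rewrite /kern; apply: measurable_fun_ifT => //.
  by apply: measurable_and; [exact: measurable_fun_ler|exact: measurable_fun_ltr].
apply: measurable_fun_ifT => //.
by apply: measurable_and; [exact: measurable_fun_ler|exact: measurable_fun_ltr].
Qed.

Lemma measurable_clip : measurable_fun setT clip.
Proof.
apply: measurable_maxr => //; apply: measurable_minr => //.
Qed.

Lemma Rintegral_itvco (g f : R -> R) (a b : R) : a <= b -> continuous g ->
  (forall x : R, is_derive x (1 : R) f (g x)) ->
  \int[mu]_(t in `[a, b[) g t = f b - f a.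
Proof.
move=> ab cg df.
have cf : continuous f.
  by move=> x; apply: differentiable_continuous; apply/derivable1_diffP; case: (df x).
move: ab; rewrite le_eqVlt => /predU1P[->|ab].
  by rewrite set_itv_ge ?bnd_simp ?ltxx// Rintegral_set0 subrr.
rewrite /Rintegral integral_itv_bndo_bndc; last first.
  by apply/measurable_EFinP/measurable_funTS; exact: continuous_measurable_fun.
rewrite (@continuous_FTC2 _ g f) //.
- exact: continuous_subspaceT.
- split.
  + by move=> x _; case: (df x).
  + exact/cvg_at_right_filter/cf.
  + exact/cvg_at_left_filter/cf.
- by move=> x _; rewrite derive1E; case: (df x).
Qed.

(** Integrating over the window truncates the interval between - y and 0, which
    is why [clip y] appears. *)
Lemma Rintegral_kern (g f : R -> R) (w y : R) : continuous g ->
  (forall x : R, is_derive x (1 : R) f (g x)) ->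
  \int[mu]_(t in window R) (g (w + t) * kern y t) = f w - f (w - clip y).
Proof.
move=> cg df.
have cgw : continuous (fun t => g (w + t)).
  move=> t; apply: (@continuous_comp _ _ _ (fun t => w + t) g); last exact: cg.
  by apply: cvgD; [exact: cvg_cst|exact: cvg_id].
have dfw (t : R) : is_derive t (1 : R) (fun t => f (w + t)) (g (w + t)).
  have h : is_derive t (1 : R) (f \o (fun t => w + t)) (g (w + t) * 1).
    apply: is_derive1_comp; have -> : [eta +%R w] = (cst w + id : R -> R) by [].
    by apply: is_derive_eq; rewrite add0r.
  by move: h; rewrite mulr1.
have /andP[c1 c2] : -1 <= clip y <= 1 by have := clip_norm_le1 y; rewrite ler_norml.
have [y0|y0] := leP 0 y.
  have cy : clip y = Num.min 1 y.
    by rewrite /clip max_r// le_min; apply/andP; split; lra.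
  have cyy : clip y <= y by rewrite cy ge_min lexx orbT.
  have cy0 : 0 <= clip y by rewrite cy le_min ler01.
  transitivity (\int[mu]_(t in window R) ((fun t => g (w + t)) \_ `[- clip y, 0[) t).
    apply: eq_Rintegral => t; rewrite inE /window/= in_itv/= => /andP[t1 t2].
    have H : (- y <= t) = (- clip y <= t).
      by rewrite cy lerNl [RHS]lerNl le_min (_ : - t <= 1)//; lra.
    rewrite patchE /kern H; case: ifPn => [Ht|Ht].
      by rewrite mem_set ?mulr1//= in_itv.
    rewrite memNset; last by rewrite /= in_itv/=; exact/negP.
    rewrite ifF ?mulr0//; apply/negbTE; rewrite negb_and -leNgt.
    by have [|//] := leP 0 t; rewrite /=; lra.
  rewrite -Rintegral_mkcondr (_ : _ `&` _ = `[- clip y, 0[%classic); last first.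
    apply/seteqP; split => t /=; rewrite !in_itv/=; first by move=> [].
    by move=> /andP[ct t0]; split; [rewrite /window/= in_itv/=; apply/andP; split; lra|rewrite ct].
  by rewrite (Rintegral_itvco _ cgw dfw) ?addr0// oppr_le0.
have cy : clip y = Num.max (-1) y by rewrite /clip min_r//; lra.
have cyy : y <= clip y by rewrite cy le_max lexx orbT.
have cy0 : clip y < 0 by rewrite cy gt_max y0 andbT; lra.
have cNgw : continuous (fun t => - g (w + t)).
  by move=> t; apply: cvgN; exact: cgw.
transitivity (\int[mu]_(t in window R) ((fun t => - g (w + t)) \_ `[0, - clip y[) t).
  apply: eq_Rintegral => t; rewrite inE /window/= in_itv/= => /andP[t1 t2].
  have H : (t < - y) = (t < - clip y).
    by rewrite cy ltrNr [RHS]ltrNr gt_max (_ : -1 < - t)//; lra.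
  rewrite patchE /kern ifF; last first.
    by apply/negbTE; rewrite negb_and -ltNge -leNgt; have [|//] := leP 0 t; rewrite ?orbT//; lra.
  rewrite H; case: ifPn => [Ht|Ht].
    by rewrite mem_set ?mulrN1//= in_itv.
  by rewrite memNset ?mulr0// /= in_itv/=; exact/negP.
rewrite -Rintegral_mkcondr (_ : _ `&` _ = `[0, - clip y[%classic); last first.
  apply/seteqP; split => t /=; rewrite !in_itv/=; first by move=> [].
  by move=> /andP[ct t0]; split; [rewrite /window/= in_itv/=; apply/andP; split; lra|rewrite ct].
rewrite (@Rintegral_itvco (fun t => - g (w + t)) (fun t => - f (w + t)))//.
- by rewrite addr0; ring.
- by rewrite oppr_ge0 ltW.
Qed.

Lemma Rintegral_kern1 y : \int[mu]_(t in window R) kern y t = clip y.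
Proof.
have := @Rintegral_kern (fun=> 1) id 0 y.
rewrite sub0r sub0r opprK => <-.
- by apply: eq_Rintegral => t _; rewrite mul1r.
- by move=> x; exact: cvg_cst.
Qed.

Lemma Rintegral_kern_norm y : \int[mu]_(t in window R) `|kern y t| = `|clip y|.
Proof.
set c : R := if 0 <= y then 1 else -1.
have -> : `|clip y| = c * clip y.
  rewrite /c; case: ifPn => y0.
    by rewrite mul1r ger0_norm// /clip le_max le_min ler01 y0 orbT.
  rewrite -ltNge in y0; rewrite mulN1r ltr0_norm// /clip gt_max gt_min y0 orbT andbT.
  by rewrite ltrN10.
transitivity (\int[mu]_(t in window R) ((fun=> c) (0 + t) * kern y t)).
  by apply: eq_Rintegral => t _; rewrite kern_norm.
rewrite -[LHS]/(\int[mu]_(t in _) _) (_ : \int[mu]_(t in _) _ = c * 0 - c * (0 - clip y)).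
  by rewrite sub0r; ring.
apply: (@Rintegral_kern (fun=> c) (fun t => c * t)).
- by move=> x; exact: cvg_cst.
- by move=> x; apply: is_derive_eq; rewrite /GRing.scale/=; ring.
Qed.

(** On the support of the kernel, t and k(y, t) have opposite signs: the integrand
    is - t k(y, t), to which [Rintegral_kern] applies. *)
Lemma Rintegral_kern_normM y : \int[mu]_(t in window R) (`|t| * `|kern y t|) = clip y ^+ 2 / 2.
Proof.
transitivity (\int[mu]_(t in window R) (- (0 + t) * kern y t)).
  by apply: eq_Rintegral => t _; rewrite kern_normM add0r mulNr.
rewrite -[LHS]/(\int[mu]_(t in _) _)
  (_ : \int[mu]_(t in _) _ = - 0 ^+ 2 / 2 - (- (0 - clip y) ^+ 2 / 2)).
  by rewrite sub0r; field.
apply: (@Rintegral_kern (fun t => - t) (fun t => - t ^+ 2 / 2)).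
- by move=> x; apply: cvgN; exact: cvg_id.
- by move=> x; apply: is_derive_eq; rewrite /GRing.scale/=; field.
Qed.

End kernel.

(** * Exchanging expectation and integration over the window *)

Section fubini.
Context {d : measure_display} {T : measurableType d} {R : realType}.
Variable P : probability T R.
Local Notation mu := (@lebesgue_measure R).
Local Notation D := (window R).

Variables (psi : T -> R -> R) (Z : T -> R).
Hypothesis mpsi : measurable_fun setT (fun p : T * R => psi p.1 p.2).
Hypothesis iZ : intg P Z.
Hypothesis psiZ : forall t (x : R), D x -> `|psi t x| <= `|Z t|.

Let mD : measurable (D : set (measurableTypeR R)). Proof. exact: measurable_itv. Qed.

(* Extended by zero outside the window, to use Fubini's theorem on the whole
   product space. *)
Let m (p : T * measurableTypeR R) : \bar R := ((psi p.1 \_ D) p.2)%:E.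

Lemma psi_measurable1 t : measurable_fun setT (psi t).
Proof.
have := @measurableT_comp _ _ _ _ _ _ _ setT _ mpsi (@pair1_measurable _ _ T R t).
by [].
Qed.

Lemma psi_measurable2 x : measurable_fun setT (psi ^~ x).
Proof.
have := @measurableT_comp _ _ _ _ _ _ _ setT _ mpsi (@pair2_measurable _ _ T R x).
by [].
Qed.

Lemma intg_psi x : D x -> intg P (psi ^~ x).
Proof.
move=> Dx; apply: (intg_le _ iZ); first exact: psi_measurable2.
by move=> t; exact: psiZ.
Qed.

Let muD : mu D = 2%:E.
Proof. by rewrite /window lebesgue_measure_itv/= lte_fin ifT ?EFinN; [congr EFin; lra|lra]. Qed.

Let integrable_bounded (f : R -> R) (c : R) : measurable_fun (D : set (measurableTypeR R)) f ->
  (forall x, D x -> `|f x| <= c) -> mu.-integrable D (EFin \o f).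
Proof.
move=> mf fc; apply: (@measurable_bounded_integrable _ _ R mu) => //.
  by move: (ltry (2 : R)); rewrite -muD.
exists c; split; first exact: num_real.
by move=> M cM x Dx; apply: le_trans (fc x Dx) (ltW cM).
Qed.

Lemma integrable_psi t : mu.-integrable D (EFin \o psi t).
Proof.
apply: (@integrable_bounded _ `|Z t|); last by move=> x; exact: psiZ.
by apply: measurable_funTS; exact: psi_measurable1.
Qed.

Let mm : measurable_fun setT m.
Proof.
suff : measurable_fun setT (m : T * R -> \bar R) by [].
apply/measurable_EFinP.
have -> : (fun p : T * R => ((psi p.1) \_ D) p.2) =
    (fun p => if (-1 <= p.2) && (p.2 < 1) then psi p.1 p.2 else 0).
  apply/funext => p; rewrite patchE.
  by rewrite /window mem_setE.
apply: measurable_fun_ifT => //; apply: measurable_and.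
  by apply: measurable_fun_ler => //; exact: measurable_snd.
by apply: measurable_fun_ltr => //; exact: measurable_snd.
Qed.

Let intm t : (\int[mu]_x `|m (t, x)| = \int[mu]_(x in D) `|psi t x|%:E)%E.
Proof.
rewrite [RHS]integral_mkcond; apply: eq_integral => x _.
by rewrite /m /= !patchE; case: ifPn => // _; rewrite normr0.
Qed.

Let im : (P \x mu)%E.-integrable setT m.
Proof.
apply/integrable12ltyP => //.
apply: (@le_lt_trans _ _ (\int[P]_t (2 * `|Z t|)%:E))%E; last first.
  have /integrableP[_] := intgZ 2 (intg_norm iZ).
  under eq_integral do rewrite /= normrM normr_id ger0_norm//.
  by [].
apply: ge0_le_integral => //.
- by move=> t _; apply: integral_ge0.
- apply: (@measurable_fun_fubini_tonelli_F _ _ _ _ R mu (abse \o m)) => //=.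
  exact: measurableT_comp.
- by apply/measurable_EFinP/measurable_funM => //; apply: measurableT_comp => //; exact: intg_measurable iZ.
- move=> t _; rewrite intm.
  apply: (@le_trans _ _ (\int[mu]_(x in D) (`|Z t|)%:E))%E.
    apply: ge0_le_integral => //.
    + apply/measurable_EFinP/measurable_funTS; apply: measurableT_comp => //.
      exact: psi_measurable1.
    + by move=> x Dx; rewrite lee_fin psiZ.
  by rewrite integral_cst// [in leRHS]mulrC EFinM -muD.
Qed.

Let E_psi x : D x -> (\int[P]_t m (t, x) = (\int[P]_t psi t x)%:E)%E.
Proof.
move=> Dx; rewrite /Rintegral fineK; last by apply: integrable_fin_num => //; exact: intg_psi.
by apply: eq_integral => t _; rewrite /m /= patchE mem_set.
Qed.

Lemma integrable_E_psi : mu.-integrable D (EFin \o (fun x => \int[P]_t psi t x)).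
Proof.
apply: (@integrable_bounded _ (\int[P]_t `|Z t|)).
  apply/measurable_EFinP.
  apply: (eq_measurable_fun (fubini_G P m)).
    by move=> x; rewrite inE => Dx; rewrite /fubini_G E_psi.
  by apply: measurable_funTS; exact: (@measurable_fubini_G _ _ _ _ R P mu m im).
move=> x Dx; apply: Enorm_le => //; [exact: intg_psi|exact: intg_norm|].
by move=> t; exact: psiZ.
Qed.

Lemma Fubini_psi :
  \int[mu]_(x in D) \int[P]_t psi t x = \int[P]_t \int[mu]_(x in D) psi t x.
Proof.
rewrite /Rintegral -[LHS]/(fine _); congr fine.
transitivity (\int[mu]_x \int[P]_t m (t, x))%E.
  rewrite [LHS]integral_mkcond; apply: eq_integral => x _.
  rewrite patchE; case: ifPn => [/set_mem Dx|nDx].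
    by rewrite E_psi.
  rewrite integral0_eq// => t _; rewrite /m /= patchE (negbTE nDx)//.
rewrite -(Fubini im); apply: eq_integral => t _.
rewrite fineK; last by apply: integrable_fin_num => //; exact: integrable_psi.
rewrite [RHS]integral_mkcond; apply: eq_integral => x _.
by rewrite /m /= !patchE; case: ifP.
Qed.

End fubini.

(** * The error of a ramp under local orthogonality *)

Section arithmetic.
Variable R : realFieldType.
Implicit Types (e mm x lam eps al delta I : R).

(** Second moment of |W| + 126/100 when E W^2 = 1 and E|W| <= 1; note that
    226/100 = 1 + 126/100. *)
Lemma square_bound e : e <= 1 ->
  1 + (252 / 100 * e + (126 / 100) ^+ 2) <= (226 / 100) ^+ 2.
Proof. lra. Qed.

(** Half the second moment of an increment of g over a step of length x, with
    the weight mm = (x / lam + 1 / eps)^-1. *)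
Lemma weighted_square_bound mm x lam eps al delta I :
  mm * x <= lam -> mm * x * x <= lam * x ->
  mm * (81 / 200 * al + 2 * delta) <= eps * (81 / 200 * al + 2 * delta) ->
  mm * I <= mm * ((226 / 100) ^+ 2 * (x * x) + 81 / 200 * (al + x) + 2 * delta) ->
  mm / 2 * I <= (lam * ((226 / 100) ^+ 2 * x + 81 / 200) +
    eps * (81 / 200 * al + 2 * delta)) / 2.
Proof. lra. Qed.

End arithmetic.

Section core.
Context {d : measure_display} {T : measurableType d} {R : realType}.
Variable P : probability T R.
Local Notation mu := (@lebesgue_measure R).
Local Notation wint f := (mu.-integrable (window R) (EFin \o f)).

Lemma measurable_window : measurable (window R : set (measurableTypeR R)).
Proof. exact: measurable_itv. Qed.
Local Hint Resolve measurable_window : core.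

Lemma Fubini_window (U : T -> R) (q : T -> R -> R) : intg P U ->
  measurable_fun setT (fun p : T * R => q p.1 p.2) ->
  (forall t x, window R x -> `|q t x| <= 1) ->
  wint (fun x => \int[P]_t (U t * q t x)) /\
  \int[mu]_(x in window R) \int[P]_t (U t * q t x) =
  \int[P]_t (U t * \int[mu]_(x in window R) q t x).
Proof.
move=> iU mq q1.
have mpsi : measurable_fun setT (fun p : T * R => U p.1 * q p.1 p.2).
  apply: measurable_funM => //.
  exact: (measurableT_comp (intg_measurable iU) (@measurable_fst _ _ _ _)).
have psiZ t x : window R x -> `|U t * q t x| <= `|U t|.
  by move=> Dx; rewrite normrM ler_piMr// q1.
split; first exact: (integrable_E_psi mpsi iU psiZ).
rewrite (Fubini_psi mpsi iU psiZ); apply: eq_Rintegral => t _.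
rewrite RintegralZl//.
apply: (@integrable_psi _ _ _ q (fun=> 1)) => //.
by move=> t' x Dx; rewrite normr1 q1.
Qed.

Lemma wint_sum (I : Type) (s : seq I) (F : I -> R -> R) :
  (forall i, wint (F i)) -> wint (fun x => \sum_(i <- s) F i x).
Proof.
move=> iF; elim: s => [|i s IH].
  under eq_fun do rewrite big_nil; exact: integrable0.
under eq_fun do rewrite big_cons.
exact: (integrableD measurable_window (iF i) IH).
Qed.

Lemma Rintegral_window_sum (I : Type) (s : seq I) (F : I -> R -> R) :
  (forall i, wint (F i)) ->
  \int[mu]_(x in window R) (\sum_(i <- s) F i x) =
  \sum_(i <- s) \int[mu]_(x in window R) F i x.
Proof.
move=> iF; elim: s => [|i s IH].
  rewrite big_nil -[RHS](mul0r (fine (mu (window R)))) -Rintegral_cst//.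
  by apply: eq_Rintegral => t _; rewrite big_nil.
rewrite big_cons -IH -RintegralD//; last exact: wint_sum.
by apply: eq_Rintegral => t _; rewrite big_cons.
Qed.

Lemma wint_cst (c : R) : wint (fun=> c).
Proof.
have mp : measurable_fun setT (fun p : T * R => (1:R)) by [].
have [] := @Fubini_window (fun=> c) (fun _ _ => 1) (intg_cst P c) mp.
  by move=> *; rewrite normr1.
move=> + _; apply: eq_integrable => // x _ /=.
by rewrite Ecst mulr1.
Qed.

Lemma window_norm_le1 (x : R) : window R x -> `|x| <= 1.
Proof. by rewrite /window/= in_itv/= ler_norml => /andP[-> /ltW]. Qed.

Lemma wint_le1 (f : R -> R) : measurable_fun setT f ->
  (forall x, window R x -> `|f x| <= 1) -> wint f.
Proof.
move=> mf f1.
have mp : measurable_fun setT (fun p : T * R => f p.2).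
  exact: (measurableT_comp mf (@measurable_snd _ _ T R)).
have [] := @Fubini_window (fun=> 1) (fun _ => f) (intg_cst P 1) mp (fun _ => f1).
by move=> + _; apply: eq_integrable => // x _ /=; rewrite Ecst mul1r.
Qed.

Lemma wint_norm : wint (fun x => `|x|).
Proof.
by apply: wint_le1 => [|x]; [exact: measurableT_comp|rewrite normr_id; exact: window_norm_le1].
Qed.

Lemma wint_norm_kern y : wint (fun x => `|x| * `|kern y x|).
Proof.
apply: wint_le1 => [|x wx].
  apply: measurable_funM; first exact: (measurableT_comp (@normr_measurable R setT) (@measurable_id _ _ _)).
  apply: measurableT_comp => //.
  exact: (measurableT_comp (@measurable_kern R) (@pair1_measurable _ _ R R y)).
by rewrite normrM !normr_id mulr_ile1// ?kern_norm_le1// window_norm_le1.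
Qed.

Lemma wintD f g : wint f -> wint g -> wint (fun x => f x + g x).
Proof. by move=> i1 i2; exact: (integrableD measurable_window i1 i2). Qed.

Lemma wintB f g : wint f -> wint g -> wint (fun x => f x - g x).
Proof. by move=> i1 i2; exact: (integrableB measurable_window i1 i2). Qed.

Lemma wintZ c f : wint f -> wint (fun x => c * f x).
Proof. exact: integrableZl_EFin. Qed.

Lemma Rintegral_window_cst (c : R) : \int[mu]_(x in window R) c = 2 * c.
Proof.
rewrite Rintegral_cst// mulrC; congr (_ * _).
have : (mu (window R) = 2%:E)%E.
  by rewrite /window lebesgue_measure_itv/= lte_fin ifT; [congr EFin; lra|lra].
by move/(congr1 fine).
Qed.

(** |t| is |t| |k(1, t)| + |t| |k(-1, t)| on the window. *)
Lemma Rintegral_window_norm : \int[mu]_(x in window R) `|x| = 1.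
Proof.
transitivity (\int[mu]_(x in window R) (`|x| * `|kern 1 x| + `|x| * `|kern (-1) x|)).
  apply: eq_Rintegral => x; rewrite inE /window/= in_itv/= => /andP[x1 x2].
  have x3 : (x < -1) = false by rewrite ltNge x1.
  have x4 : (1 <= x) = false by rewrite leNgt x2.
  rewrite -mulrDr /kern x1 opprK x2 x3 x4 !andbF /=.
  by case: (leP 0 x) => /= _; rewrite ?normr0 ?normrN normr1 ?addr0 ?add0r mulr1.
rewrite RintegralD//; [|exact: wint_norm_kern|exact: wint_norm_kern].
rewrite !Rintegral_kern_normM /clip min_l// min_r ?max_r ?maxxx; lra.
Qed.

Lemma Fubini_window_sum (I : finType) (U : I -> T -> R) (q : I -> T -> R -> R)
    (c : I -> T -> R) :
  (forall i, intg P (U i)) ->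
  (forall i, measurable_fun setT (fun p : T * R => q i p.1 p.2)) ->
  (forall i t x, window R x -> `|q i t x| <= 1) ->
  (forall i t, \int[mu]_(x in window R) q i t x = c i t) ->
  wint (fun x => \sum_i \int[P]_t (U i t * q i t x)) /\
  \int[mu]_(x in window R) (\sum_i \int[P]_t (U i t * q i t x)) =
  \sum_i \int[P]_t (U i t * c i t).
Proof.
move=> iU mq q1 qc.
have H i := Fubini_window (iU i) (mq i) (q1 i).
split; first by apply: wint_sum => i; case: (H i).
rewrite Rintegral_window_sum; last by move=> i; case: (H i).
apply: eq_bigr => i _; have [_ ->] := H i.
by apply: eq_Rintegral => t _; rewrite qc.
Qed.

(** Cauchy-Schwarz in the additive form, whose free weight m may depend on the
    integration variable t. *)
Lemma E_amgm (U V : T -> R) (m : R) : 0 < m -> sqint P U -> sqint P V ->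
  `|\int[P]_t (U t * V t)| <=
  m / 2 * \int[P]_t (U t ^+ 2) + (2 * m)^-1 * \int[P]_t (V t ^+ 2).
Proof.
move=> m0 sU sV; have [_ iU] := sU; have [_ iV] := sV.
rewrite -!EZ// -ED; [|exact: intgZ|exact: intgZ].
apply: Enorm_le; [exact: sqintM|by apply: intgD; exact: intgZ|].
move=> t; set u := U t; set v := V t.
have m2 : 0 < 2 * m by rewrite mulr_gt0.
have e : m / 2 * u ^+ 2 + (2 * m)^-1 * v ^+ 2 = (2 * m)^-1 * ((m * u) ^+ 2 + v ^+ 2).
  by field; rewrite gt_eqF.
rewrite e [leRHS]mulrC ler_pdivlMr//.
have := sqr_ge0 (m * u - v); have := sqr_ge0 (m * u + v).
by case: (ger0P (u * v)) => _ ? ?; lra.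
Qed.

Context {J : finType}.
Variables (X Y : J -> T -> R) (kappa delta : R).
Let W t := \sum_i X i t.
Hypothesis sX : forall i, sqint P (X i).
Hypothesis sY : forall i, sqint P (Y i).
Hypothesis orthogonal : forall i (f : R -> R), continuous f ->
  (exists C : R, forall x, `|f x| <= C) -> \int[P]_t (X i t * f (W t - Y i t)) = 0.
Hypothesis sumXY : \sum_i \int[P]_t (X i t * Y i t) = 1.
Hypothesis EW2 : \int[P]_t (W t ^+ 2) = 1.
Hypothesis variance_le : forall g : R -> R, measurable_fun setT g ->
  (forall y, `|g y| <= 1) ->
  \int[P]_t ((\sum_i X i t * g (Y i t) -
     \int[P]_t (\sum_i X i t * g (Y i t))) ^+ 2) <=
  kappa * \sum_i \int[P]_t ((X i t * g (Y i t)) ^+ 2).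

Let F (z : R) := \int[P]_t (if W t <= z then 1 else 0).
Hypothesis deltaP : forall z, `|F z - Phi z| <= delta.

Let sW : sqint P W. Proof. exact: sqint_sum. Qed.
Let mW : measurable_fun setT W. Proof. by case: sW. Qed.

Let EW1 : \int[P]_t `|W t| <= 1.
Proof.
have := @E_amgm (fun t => `|W t|) (fun=> 1) 1 ltr01 (sqint_norm sW) (sqint_cst P 1).
under [X in `|X|]eq_Rintegral do rewrite mulr1.
have -> : \int[P]_t (`|W t| ^+ 2) = 1.
  by rewrite -EW2; apply: eq_Rintegral => t _; rewrite real_normK// num_real.
rewrite expr1n Ecst => H; apply: le_trans (ler_norm _) (le_trans H _); lra.
Qed.

Let intg_bool (b : T -> bool) : measurable_fun setT b ->
  intg P (fun t => if b t then 1 else 0).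
Proof.
move=> mb; apply: (intg_le _ (intg_cst P 1)) => [|t].
  exact: measurable_fun_ifT.
by case: (b t); rewrite ?normr1// normr0 ler01.
Qed.

(* Bootstrap: the distribution function of W is compared with Phi at both ends. *)
Let concentration a b : a <= b ->
  \int[P]_t (if a < W t <= b then 1 else 0) <= 81 / 200 * (b - a) + 2 * delta.
Proof.
move=> ab.
have -> : \int[P]_t (if a < W t <= b then 1 else 0) = F b - F a.
  rewrite /F -EB; last 2 first.
  - by apply: intg_bool; apply: measurable_fun_ler.
  - by apply: intg_bool; apply: measurable_fun_ler.
  apply: eq_Rintegral => t _.
  have [Wa|Wa] /= := leP (W t) a; first by rewrite (le_trans Wa ab) subrr.
  by rewrite subr0.
have := Phi_increment ab; have := deltaP a; have := deltaP b.
by rewrite !ler_norml => /andP[_ ?] /andP[? _]; lra.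
Qed.

Section fixed_ramp.
Variables (z al : R).
Hypothesis al0 : 0 < al.
Let h := ramp z al.
Let f := stein h.
Let g := dstein h.
Let N := normal_mean h.
Let ch : continuous h := @ramp_continuous R z al.
Let h01 : forall x, 0 <= h x <= 1 := @ramp01 R z al.
Let hn : forall x y, x <= y -> h y <= h x := @ramp_nonincreasing R z al al0.
Let cf : continuous f := stein_continuous ch h01.
Let cg : continuous g := dstein_continuous ch h01.
Let df (w : R) : is_derive w (1 : R) f (g w) := stein_equation ch h01 w.
Let f0 w : 0 <= f w := stein_ge0 ch h01 hn w.
Let f1 w : f w <= 126 / 100 := stein_le ch h01 w.
Let g1 w : `|g w| <= 1 := dstein_norm_le1 ch h01 hn w.
Let mf : measurable_fun setT f := continuous_measurable_fun cf.
Let mg : measurable_fun setT g := continuous_measurable_fun cg.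
Let mh : measurable_fun setT h := continuous_measurable_fun ch.

Let supp (w x : R) := z - Num.max x 0 < w <= z + al + Num.max (- x) 0.

Let E_supp x : \int[P]_t (if supp (W t) x then 1 else 0) <= 81 / 200 * (al + `|x|) + 2 * delta.
Proof.
have -> : al + `|x| = (z + al + Num.max (- x) 0) - (z - Num.max x 0).
  case: (ger0P x) => x0.
    by rewrite max_r; lra.
  by rewrite max_l; lra.
apply: concentration.
have : 0 <= Num.max x 0 by rewrite le_max lexx orbT.
have : 0 <= Num.max (- x) 0 by rewrite le_max lexx orbT.
by move=> p1 p2; rewrite lerBlDr -!addrA lerDl !addr_ge0// ltW.
Qed.

Let msupp x : measurable_fun setT (fun t => supp (W t) x).
Proof.
by apply: measurable_and; [exact: measurable_fun_ltr|exact: measurable_fun_ler].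
Qed.

Let isupp x : intg P (fun t => if supp (W t) x then 1 else 0).
Proof. exact: intg_bool. Qed.

Let h_incr w x : `|h (w + x) - h w| <= Num.min 1 (`|x| / al) * (if supp w x then 1 else 0).
Proof.
case: ifPn => [_|]; last first.
  move=> ns; rewrite mulr0 (_ : h (w + x) = h w) ?subrr ?normr0//.
  by apply/eqP; rewrite eq_sym; apply: contraNT ns; exact: ramp_increment_support.
rewrite mulr1 le_min; apply/andP; split.
  by have /andP[? ?] := h01 w; have /andP[? ?] := h01 (w + x); rewrite ler_norml; apply/andP; split; lra.
by have := ramp_lipschitz z al0 (w + x) w; rewrite addrAC subrr add0r.
Qed.

Let delta0 : 0 <= delta.
Proof. exact: le_trans (deltaP 0). Qed.

(* 226/100 comes from w f(w), 81/100 + 2 delta / al from the ramp: E_supp bounds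
   the probability that it varies, and its slope is 1 / al.  The part al of the
   length of the interval contributes |x| / al * al, the part |x| is bounded with
   the total variation 1 of the ramp. *)
Let M := 226 / 100 + 81 / 100 + 2 * delta / al.

Let mgW x : measurable_fun setT (fun t => g (W t + x)).
Proof. by apply: measurableT_comp => //; exact: measurable_funD. Qed.

Let sgW x : sqint P (fun t => g (W t + x)).
Proof.
apply: (sqint_le (mgW x) (sqint_cst P 1)) => t; by rewrite normr1.
Qed.

Let sgW0 : sqint P (fun t => g (W t)).
Proof.
by apply: (sqint_le _ (sqint_cst P 1)) => [|t]; [exact: measurableT_comp|rewrite normr1].
Qed.

Let E_g_incr x : `|\int[P]_t g (W t) - \int[P]_t g (W t + x)| <= `|x| * M.
Proof.
rewrite -EB; [|exact: sqint_intg|exact: sqint_intg].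
apply: (@le_trans _ _ (\int[P]_t (`|x| * (`|W t| + 126 / 100) +
    Num.min 1 (`|x| / al) * (if supp (W t) x then 1 else 0)))).
  apply: Enorm_le.
  - by apply: intgB; exact: sqint_intg.
  - apply: intgD; last exact: intgZ.
    apply: intgZ; apply: intgD; last exact: intg_cst.
    exact/sqint_intg/sqint_norm.
  - move=> t; rewrite distrC /g /dstein.
    rewrite (_ : _ - _ = ((W t + x) * f (W t + x) - W t * f (W t)) + (h (W t + x) - h (W t))); last by rewrite /f; ring.
    apply: le_trans (ler_normD _ _) _; apply: lerD; last exact: h_incr.
    exact: (mul_stein_lipschitz ch h01 hn).
rewrite ED; last 2 first.
- apply: intgZ; apply: intgD; last exact: intg_cst.
  exact/sqint_intg/sqint_norm.
- exact: intgZ.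
rewrite !EZ//; last first.
  apply: intgD; last exact: intg_cst.
  exact/sqint_intg/sqint_norm.
rewrite ED; [|exact/sqint_intg/sqint_norm|exact: intg_cst].
rewrite Ecst.
set m := Num.min 1 _.
have m0 : 0 <= m by rewrite /m le_min ler01 divr_ge0// ltW.
have m1 : m <= 1 by rewrite /m ge_min lexx.
have m2 : m <= `|x| / al by rewrite /m ge_min lexx orbT.
have m3 : m * al <= `|x| by rewrite -ler_pdivlMr.
have H1 : m * \int[P]_t (if supp (W t) x then 1 else 0) <=
    m * (81 / 200 * (al + `|x|) + 2 * delta) by rewrite ler_wpM2l ?E_supp.
have H2 : m * `|x| <= `|x| by rewrite ler_piMl.
have H3 : m * delta <= `|x| / al * delta by rewrite ler_wpM2r.
have H4 : `|x| * \int[P]_t `|W t| <= `|x| * 1 by rewrite ler_wpM2l.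
rewrite /M (_ : `|x| * (226 / 100 + 81 / 100 + 2 * delta / al) =
  `|x| * (307 / 100) + 2 * (`|x| / al * delta)); last by field; rewrite gt_eqF.
lra.
Qed.

Let E_g_incr_sqr x : \int[P]_t ((g (W t + x) - g (W t)) ^+ 2) <=
  (226 / 100) ^+ 2 * x ^+ 2 + 81 / 200 * (al + `|x|) + 2 * delta.
Proof.
have i1 : intg P (fun t => x ^+ 2 * (`|W t| + 126 / 100) ^+ 2).
  apply: intgZ; suff [] : sqint P (fun t => `|W t| + 126 / 100) by [].
  by apply: sqintD; [exact: sqint_norm|exact: sqint_cst].
apply: (@le_trans _ _ (\int[P]_t (x ^+ 2 * (`|W t| + 126 / 100) ^+ 2 +
    (if supp (W t) x then 1 else 0)))).
  apply: Ele.
  - by case: (sqintB (sgW x) sgW0).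
  - exact: intgD.
  - move=> t; apply: le_trans (dstein_sqr_increment ch h01 hn _ _) _.
    apply: lerD.
      rewrite -(real_normK (num_real (_ - _))) -(real_normK (num_real x)) -exprMn.
      by rewrite lerXn2r ?nnegrE ?mulr_ge0 ?addr_ge0//; exact: (mul_stein_lipschitz ch h01 hn).
    rewrite -(real_normK (num_real (_ - _))).
    have := h_incr (W t) x; case: ifP => _.
      rewrite mulr1 => H; rewrite exprn_ile1// (le_trans H)// ge_min lexx//.
    by rewrite mulr0 normr_le0 => /eqP ->; rewrite normr0 expr0n.
rewrite ED// EZ; last by suff [] : sqint P (fun t => `|W t| + 126 / 100) by [];
  apply: sqintD; [exact: sqint_norm|exact: sqint_cst].
rewrite -addrA; apply: lerD; last exact: E_supp.
rewrite [leRHS]mulrC ler_wpM2l ?sqr_ge0//.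
have -> : \int[P]_t (`|W t| + 126 / 100) ^+ 2 =
    \int[P]_t (W t ^+ 2 + (252 / 100 * `|W t| + (126 / 100) ^+ 2)).
  by apply: eq_Rintegral => t _; rewrite -[in RHS](real_normK (num_real (W t))); field.
rewrite ED; last 2 first.
- by case: sW.
- by apply: intgD; [apply: intgZ; exact/sqint_intg/sqint_norm|exact: intg_cst].
rewrite ED; [|by apply: intgZ; exact/sqint_intg/sqint_norm|exact: intg_cst].
rewrite EZ; last exact/sqint_intg/sqint_norm.
by rewrite EW2 Ecst; exact: square_bound EW1.
Qed.

(* Kh is the random kernel Khat, K its mean; m, v and vx are the integrands whose
   integrals over the window are the moment expressions b / 2, v1 and v2 / 2. *)
Let Kh x t := \sum_i X i t * kern (Y i t) x.
Let K x := \int[P]_t Kh x t.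
Let m x := \sum_i \int[P]_t (`|X i t| * (`|x| * `|kern (Y i t) x|)).
Let v x := \sum_i \int[P]_t (X i t ^+ 2 * `|kern (Y i t) x|).
Let vx x := \sum_i \int[P]_t (X i t ^+ 2 * (`|x| * `|kern (Y i t) x|)).

Let mkern x : measurable_fun setT (fun y : R => kern y x).
Proof. exact: (measurableT_comp (@measurable_kern R) (@pair2_measurable _ _ R R x)). Qed.

Let mY i : measurable_fun setT (Y i). Proof. by case: (sY i). Qed.

Let mkernY i x : measurable_fun setT (fun t => kern (Y i t) x).
Proof. exact: (measurableT_comp (mkern x)). Qed.

Let sXk i x : sqint P (fun t => X i t * kern (Y i t) x).
Proof. by apply: (sqintMb (mkernY i x)) => // t; exact: kern_norm_le1. Qed.

Let sKh x : sqint P (Kh x). Proof. by apply: sqint_sum. Qed.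

Let VarK x : \int[P]_t ((Kh x t - K x) ^+ 2) <= kappa * v x.
Proof.
have := variance_le (mkern x) (fun y => kern_norm_le1 y x).
move=> H; apply: (le_trans H); rewrite le_eqVlt; apply/orP; left; apply/eqP.
congr (_ * _); apply: eq_bigr => i _; apply: eq_Rintegral => t _.
by rewrite exprMn kern_sqr.
Qed.

Let K_le x : `|x| * `|K x| <= m x.
Proof.
rewrite /K Esum; last by move=> i; exact: sqint_intg.
apply: (@le_trans _ _ (`|x| * \sum_i `|\int[P]_t (X i t * kern (Y i t) x)|)).
  by rewrite ler_wpM2l// ler_norm_sum.
rewrite mulr_sumr; apply: ler_sum => i _.
apply: (@le_trans _ _ (`|x| * \int[P]_t `|X i t * kern (Y i t) x|)).
  by rewrite ler_wpM2l// Enorm//; exact: sqint_intg.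
rewrite -EZ; last exact/intg_norm/sqint_intg.
by rewrite le_eqVlt; apply/orP; left; apply/eqP; apply: eq_Rintegral => t _;
  rewrite normrM mulrCA.
Qed.

(* The integrand of the error term at t = x. *)
Let theta x := K x * \int[P]_t g (W t) - \int[P]_t (g (W t + x) * Kh x t).

Let theta_split x : theta x = K x * (\int[P]_t g (W t) - \int[P]_t g (W t + x)) -
   \int[P]_t (g (W t + x) * (Kh x t - K x)).
Proof.
have -> : \int[P]_t (g (W t + x) * (Kh x t - K x)) =
    \int[P]_t (g (W t + x) * Kh x t - K x * g (W t + x)).
  by apply: eq_Rintegral => t _; ring.
rewrite EB; [|exact: sqintM|by apply: intgZ; exact: sqint_intg].
by rewrite EZ; [rewrite /theta; ring|exact: sqint_intg].
Qed.

Let sKK x : sqint P (fun t => Kh x t - K x).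
Proof. by apply: sqintB => //; exact: sqint_cst. Qed.

Let K_part x : `|K x * (\int[P]_t g (W t) - \int[P]_t g (W t + x))| <= M * m x.
Proof.
rewrite normrM; apply: (@le_trans _ _ (`|K x| * (`|x| * M))).
  by rewrite ler_wpM2l.
by rewrite mulrA mulrC (mulrC `|K x|) ler_wpM2l// /M !addr_ge0 ?divr_ge0 ?mulr_ge0// ltW.
Qed.

Let theta_le_rough x lam : 0 < lam ->
  `|theta x| <= M * m x + lam / 2 + kappa / (2 * lam) * v x.
Proof.
move=> lam0; rewrite theta_split.
apply: le_trans (ler_normB _ _) _; rewrite -addrA; apply: lerD; first exact: K_part.
apply: le_trans (E_amgm lam0 (sgW x) (sKK x)) _.
apply: lerD.
  rewrite ler_piMr ?divr_ge0 ?(ltW lam0)//.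
  rewrite -(Ecst P 1); apply: Ele; [by case: (sgW x)|exact: intg_cst|].
  by move=> t; rewrite -(real_normK (num_real _)) exprn_ile1.
rewrite mulrAC [leRHS]mulrC ler_wpM2l ?invr_ge0 ?mulr_ge0 ?(ltW lam0)//.
Qed.

(* The weight mm balances the two contributions to the second moment of the
   increment of g: of order |x| on the one hand, constant in x on the other. *)
Let theta_le_fine x lam eps : 0 < lam -> 0 < eps ->
  `|theta x + (\int[P]_t (g (W t) * (Kh x t - K x)))| <=
  M * m x + (lam * ((226 / 100) ^+ 2 * `|x| + 81 / 200) +
   eps * (81 / 200 * al + 2 * delta)) / 2 +
  kappa / 2 * (vx x / lam + v x / eps).
Proof.
move=> lam0 eps0.
have -> : theta x + (\int[P]_t (g (W t) * (Kh x t - K x))) =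
  K x * (\int[P]_t g (W t) - \int[P]_t g (W t + x)) -
   \int[P]_t ((g (W t + x) - g (W t)) * (Kh x t - K x)).
  rewrite theta_split -addrA; congr (_ + _).
  rewrite addrC -EB; [|exact: sqintM|exact: sqintM].
  have -> : \int[P]_t ((g (W t + x) - g (W t)) * (Kh x t - K x)) =
    \int[P]_t ((-1) * (g (W t) * (Kh x t - K x) - g (W t + x) * (Kh x t - K x))).
    by apply: eq_Rintegral => t _; ring.
  by rewrite EZ ?mulN1r ?opprK//; apply: intgB; exact: sqintM.
apply: le_trans (ler_normB _ _) _; rewrite -addrA; apply: lerD; first exact: K_part.
pose mm := (`|x| / lam + eps^-1)^-1.
have s0 : 0 < `|x| / lam + eps^-1 by rewrite ltr_wpDl ?divr_ge0 ?(ltW lam0)// invr_gt0.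
have mm0 : 0 < mm by rewrite invr_gt0.
have mml : mm * `|x| <= lam.
  rewrite /mm ler_pdivrMl// mulrDl divfK ?gt_eqF//.
  by rewrite lerDl mulr_ge0 ?invr_ge0 ?(ltW eps0) ?(ltW lam0).
have mme : mm <= eps.
  rewrite /mm invf_ple ?posrE// lerDr divr_ge0// ltW//.
apply: le_trans (E_amgm mm0 (sqintB (sgW x) sgW0) (sKK x)) _.
apply: lerD.
  have := ler_wpM2l (ltW mm0) (E_g_incr_sqr x).
  have x2 : x ^+ 2 = `|x| * `|x| by rewrite -expr2 real_normK// num_real.
  have xx := ler_wpM2r (normr_ge0 x) mml.
  have d2 : mm * (81 / 200 * al + 2 * delta) <= eps * (81 / 200 * al + 2 * delta).
    by rewrite ler_wpM2r// addr_ge0 ?mulr_ge0// ltW.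
  rewrite x2; exact: weighted_square_bound.
have -> : (2 * mm)^-1 = (`|x| / lam + eps^-1) / 2.
  by rewrite invfM invrK mulrC.
have vxE : vx x = `|x| * v x.
  rewrite /vx /v mulr_sumr; apply: eq_bigr => i _; rewrite -EZ.
    by apply: eq_Rintegral => t _; rewrite mulrCA.
  have [_] := sXk i x; apply: (eq_integrable measurableT) => t _ /=.
  by rewrite exprMn kern_sqr.
rewrite vxE (_ : kappa / 2 * _ = (`|x| / lam + eps^-1) / 2 * (kappa * v x)); last first.
  by field; rewrite !gt_eqF.
by rewrite ler_wpM2l ?VarK// divr_ge0// ltW.
Qed.

Let a := \sum_i \int[P]_t (`|X i t| * `|Y i t - clip (Y i t)|).
Let b := \sum_i \int[P]_t (`|X i t| * clip (Y i t) ^+ 2).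
Let v1 := \sum_i \int[P]_t (X i t ^+ 2 * `|clip (Y i t)|).
Let v2 := \sum_i \int[P]_t (X i t ^+ 2 * clip (Y i t) ^+ 2).

Let mkYx i : measurable_fun setT (fun p : T * R => kern (Y i p.1) p.2).
Proof.
apply: (measurableT_comp (@measurable_kern R) (g := fun p : T * R => (Y i p.1, p.2))).
apply: measurable_fun_pair; last exact: measurable_snd.
exact: (measurableT_comp (mY i) (@measurable_fst _ _ T R)).
Qed.

Let mgx : measurable_fun setT (fun p : T * R => g (W p.1 + p.2)).
Proof.
apply: measurableT_comp => //; apply: measurable_funD; last exact: measurable_snd.
exact: (measurableT_comp mW (@measurable_fst _ _ T R)).
Qed.

Let mnx : measurable_fun setT (fun p : T * R => `|p.2|).
Proof. by apply: measurableT_comp => //; exact: measurable_snd. Qed.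

Let mnkYx i : measurable_fun setT (fun p : T * R => `|kern (Y i p.1) p.2|).
Proof. exact: measurableT_comp. Qed.

Let mcY i : measurable_fun setT (fun t => clip (Y i t)).
Proof. exact: (measurableT_comp (@measurable_clip R)). Qed.

Let sXc i : sqint P (fun t => X i t * clip (Y i t)).
Proof.
by apply: (@sqintMb _ _ _ P _ _ 1) => // t; exact: clip_norm_le1.
Qed.

Let nkern1 i t x : window R x -> `| `|x| * `|kern (Y i t) x| | <= 1.
Proof.
by move=> wx; rewrite normrM !normr_id mulr_ile1// ?kern_norm_le1// window_norm_le1.
Qed.

Let sX2 i : intg P (fun t => X i t ^+ 2). Proof. by case: (sX i). Qed.

Let window_m : wint m /\ \int[mu]_(x in window R) m x = b / 2.
Proof.
have [||||-> ->] := @Fubini_window_sum J (fun i t => `|X i t|)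
  (fun i t x => `|x| * `|kern (Y i t) x|) (fun i t => clip (Y i t) ^+ 2 / 2).
- by move=> i; exact/intg_norm/sqint_intg.
- by move=> i; exact: (measurable_funM mnx (mnkYx i)).
- exact: nkern1.
- by move=> i t; exact: Rintegral_kern_normM.
split => //; rewrite /b mulr_suml; apply: eq_bigr => i _.
rewrite mulrC -EZ; first by apply: eq_Rintegral => t _; ring.
have /sqint_norm sXn := sX i.
apply: (@sqintMb_intg _ _ _ P (fun t => `|X i t|) _ 1) => //.
  by apply: measurable_funX; exact: mcY.
by move=> t; rewrite normrX exprn_ile1// clip_norm_le1.
Qed.

Let window_v : wint v /\ \int[mu]_(x in window R) v x = v1.
Proof.
apply: (@Fubini_window_sum J (fun i t => X i t ^+ 2)
  (fun i t x => `|kern (Y i t) x|)) => //.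
- by move=> i t x _; rewrite normr_id kern_norm_le1.
- by move=> i t; exact: Rintegral_kern_norm.
Qed.

Let window_vx : wint vx /\ \int[mu]_(x in window R) vx x = v2 / 2.
Proof.
have [||||-> ->] := @Fubini_window_sum J (fun i t => X i t ^+ 2)
  (fun i t x => `|x| * `|kern (Y i t) x|) (fun i t => clip (Y i t) ^+ 2 / 2).
- by [].
- by move=> i; exact: (measurable_funM mnx (mnkYx i)).
- exact: nkern1.
- by move=> i t; exact: Rintegral_kern_normM.
split => //; rewrite /v2 mulr_suml; apply: eq_bigr => i _.
rewrite mulrC -EZ; first by apply: eq_Rintegral => t _; ring.
have [_] := sXc i; apply: (eq_integrable measurableT) => t _ /=.
by rewrite exprMn.
Qed.

Let KE x : K x = \sum_i \int[P]_t (X i t * kern (Y i t) x).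
Proof. by rewrite /K Esum// => i; exact: sqint_intg. Qed.

Let window_K : wint K /\ \int[mu]_(x in window R) K x =
  \sum_i \int[P]_t (X i t * clip (Y i t)).
Proof.
have -> : K = (fun x => \sum_i \int[P]_t (X i t * kern (Y i t) x)) by apply/funext.
apply: (@Fubini_window_sum J X (fun i t x => kern (Y i t) x)).
- by move=> i; exact: sqint_intg.
- exact: mkYx.
- by move=> i t x _; exact: kern_norm_le1.
- by move=> i t; exact: Rintegral_kern1.
Qed.

Let gK x := \int[P]_t (g (W t + x) * Kh x t).

Let window_gK : wint gK /\ \int[mu]_(x in window R) gK x =
  \sum_i \int[P]_t (X i t * (f (W t) - f (W t - clip (Y i t)))).
Proof.
have -> : gK = (fun x => \sum_i \int[P]_t (X i t * (g (W t + x) * kern (Y i t) x))).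
  apply/funext => x; rewrite /gK /Kh -Esum.
    by apply: eq_Rintegral => t _; rewrite mulr_sumr; apply: eq_bigr => i _; ring.
  move=> i; have := sqintM (sgW x) (sXk i x).
  by apply: (eq_integrable measurableT) => t _ /=; rewrite mulrCA.
apply: (@Fubini_window_sum J X (fun i t x => g (W t + x) * kern (Y i t) x)).
- by move=> i; exact: sqint_intg.
- by move=> i; exact: measurable_funM.
- by move=> i t x _; rewrite normrM mulr_ile1// kern_norm_le1.
- by move=> i t; exact: Rintegral_kern.
Qed.

(* The contribution of g(W), separated from that of g(W + t) - g(W). *)
Let eta x := \int[P]_t (g (W t) * (Kh x t - K x)).

Let Q t := \sum_i X i t * clip (Y i t).

Let sQ : sqint P Q. Proof. exact: sqint_sum. Qed.

(* g(W) does not depend on the integration variable, so the kernels integrate to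
   the truncated variables before any variance is taken. *)
Let window_eta : wint eta /\ \int[mu]_(x in window R) eta x =
  \int[P]_t (g (W t) * (Q t - \int[P]_t Q t)).
Proof.
have [i1 e1] : wint (fun x => \sum_i \int[P]_t (X i t * (g (W t) * kern (Y i t) x))) /\
  \int[mu]_(x in window R) (\sum_i \int[P]_t (X i t * (g (W t) * kern (Y i t) x))) =
  \sum_i \int[P]_t (X i t * (g (W t) * clip (Y i t))).
  apply: (@Fubini_window_sum J X (fun i t x => g (W t) * kern (Y i t) x)).
  - by move=> i; exact: sqint_intg.
  - move=> i; apply: measurable_funM => //.
    by apply: (measurableT_comp mg); exact: (measurableT_comp mW (@measurable_fst _ _ T R)).
  - by move=> i t x _; rewrite normrM mulr_ile1// kern_norm_le1.
  - move=> i t; rewrite RintegralZl ?Rintegral_kern1//.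
    apply: wint_le1; last by move=> x _; exact: kern_norm_le1.
    exact: (measurableT_comp (@measurable_kern R) (@pair1_measurable _ _ R R _)).
have gc U (c : R) : sqint P U -> \int[P]_t (g (W t) * (U t - c)) =
    \int[P]_t (g (W t) * U t) - c * \int[P]_t g (W t).
  move=> sU; rewrite -EZ; last exact: sqint_intg.
  rewrite -EB; [|exact: sqintM|by apply: intgZ; exact: sqint_intg].
  by apply: eq_Rintegral => t _; ring.
have E : eta = (fun x => \sum_i \int[P]_t (X i t * (g (W t) * kern (Y i t) x)) -
    (\int[P]_t g (W t)) * K x).
  apply/funext => x; rewrite /eta gc// [in RHS]mulrC; congr (_ - _).
  rewrite -Esum; last first.
    move=> i; have := sqintM sgW0 (sXk i x).
    by apply: (eq_integrable measurableT) => t _ /=; rewrite mulrCA.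
  by apply: eq_Rintegral => t _; rewrite /Kh mulr_sumr; apply: eq_bigr => i _; ring.
have [iK eK] := window_K.
rewrite E; split; first by apply: wintB => //; exact: wintZ.
rewrite RintegralB//; last exact: wintZ.
rewrite (RintegralZl _ _ iK)// e1 eK gc// mulrC; congr (_ - _ * _).
  rewrite -Esum; last first.
    move=> i; have := sqintM sgW0 (sXc i).
    by apply: (eq_integrable measurableT) => t _ /=; rewrite mulrCA.
  by apply: eq_Rintegral => t _; rewrite /Q mulr_sumr; apply: eq_bigr => i _; ring.
by rewrite /Q Esum// => i; exact: sqint_intg.
Qed.

Let Q_var : \int[P]_t ((Q t - \int[P]_t Q t) ^+ 2) <= kappa * v2.
Proof.
have H := variance_le (@measurable_clip R) (@clip_norm_le1 R).
apply: (le_trans H); rewrite le_eqVlt; apply/orP; left; apply/eqP.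
by congr (_ * _); apply: eq_bigr => i _; apply: eq_Rintegral => t _; rewrite exprMn.
Qed.

Let eta_le lam' : 0 < lam' ->
  `|\int[mu]_(x in window R) eta x| <= lam' / 2 + kappa * v2 / (2 * lam').
Proof.
move=> l0; have [_ ->] := window_eta.
apply: le_trans (E_amgm l0 sgW0 (sqintB sQ (sqint_cst P _))) _.
apply: lerD.
  rewrite ler_piMr ?divr_ge0 ?(ltW l0)//.
  rewrite -(Ecst P 1); apply: Ele; [by case: sgW0|exact: intg_cst|].
  by move=> t; rewrite -(real_normK (num_real _)) exprn_ile1.
by rewrite mulrC ler_wpM2r ?Q_var// invr_ge0 mulr_ge0// ltW.
Qed.

Let window_theta : wint theta /\ \int[mu]_(x in window R) theta x =
  (\sum_i \int[P]_t (X i t * clip (Y i t))) * \int[P]_t g (W t) -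
  \sum_i \int[P]_t (X i t * (f (W t) - f (W t - clip (Y i t)))).
Proof.
have [iK eK] := window_K; have [iG eG] := window_gK.
have E : theta = (fun x => (\int[P]_t g (W t)) * K x - gK x).
  by apply/funext => x; rewrite /theta mulrC.
rewrite E; split; first by apply: wintB => //; exact: wintZ.
rewrite RintegralB//; last exact: wintZ.
by rewrite RintegralZl// eK eG mulrC.
Qed.

Let sfW (u : T -> R) : measurable_fun setT u -> sqint P (fun t => f (W t - u t)).
Proof.
move=> mu'; apply: (sqint_le _ (sqint_cst P (126 / 100))) => [|t].
  by apply: measurableT_comp => //; exact: measurable_funB.
by rewrite !ger0_norm// ?f0 ?f1// divr_ge0.
Qed.

(* The two truncation errors, of f(W - Y_i) against f(W - clip Y_i) and of the
   E X_i Y_i against the E X_i (clip Y_i), cost a each: f is 1-Lipschitz and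
   |g| <= 1. *)
Let stein_decomposition :
  `|\int[P]_t h (W t) - N| <= 2 * a + `|\int[mu]_(x in window R) theta x|.
Proof.
have sfW0 : sqint P (fun t => f (W t)).
  have := sfW (@measurable_cst _ _ T R setT 0).
  by under eq_fun do rewrite subr0.
have D : \int[P]_t h (W t) - N = \int[P]_t g (W t) - \int[P]_t (W t * f (W t)).
  rewrite -(Ecst P N) -!EB.
  - by apply: eq_Rintegral => t _; rewrite /g /dstein -/f -/N; ring.
  - exact: sqint_intg.
  - exact: sqintM.
  - apply: sqint_intg; apply: (sqint_le _ (sqint_cst P 1)) => [|t].
      exact: measurableT_comp.
    by have /andP[? ?] := h01 (W t); rewrite normr1 ger0_norm.
  - exact: intg_cst.
pose SXc := \sum_i \int[P]_t (X i t * clip (Y i t)).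
pose SXr := \sum_i \int[P]_t (X i t * (Y i t - clip (Y i t))).
pose S1 := \sum_i \int[P]_t (X i t * (f (W t) - f (W t - clip (Y i t)))).
pose S2 := \sum_i \int[P]_t (X i t * (f (W t - clip (Y i t)) - f (W t - Y i t))).
have WfW : \int[P]_t (W t * f (W t)) = S1 + S2.
  transitivity (\sum_i \int[P]_t (X i t * f (W t))).
    rewrite -Esum; last by move=> i; exact: sqintM.
    by apply: eq_Rintegral => t _; rewrite mulr_suml.
  rewrite /S1 /S2 -big_split/=; apply: eq_bigr => i _.
  have bf : exists C : R, forall x, `|f x| <= C.
    by exists (126 / 100) => x; rewrite ger0_norm.
  have o := orthogonal i cf bf.
  rewrite -ED; last 2 first.
  - by apply: sqintM => //; apply: sqintB => //; exact: sfW.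
  - by apply: sqintM => //; apply: sqintB => //; exact: sfW.
  rewrite -[LHS]subr0 -o -EB; last 2 first.
  - exact: sqintM.
  - by apply: sqintM => //; exact: sfW.
  by apply: eq_Rintegral => t _; ring.
have XY : 1 = SXc + SXr.
  rewrite -sumXY /SXc /SXr -big_split/=; apply: eq_bigr => i _.
  rewrite -ED; last 2 first.
  - exact: sqint_intg.
  - apply: sqintM => //; apply: sqintB => //.
    apply: (sqint_le _ (sqint_cst P 1)) => [|t]; first exact: mcY.
    by rewrite normr1 clip_norm_le1.
  by apply: eq_Rintegral => t _; ring.
have [_ ->] := window_theta; rewrite -/SXc -/S1.
have sr i : sqint P (fun t => `|Y i t - clip (Y i t)|).
  apply/sqint_norm/sqintB => //; apply: (sqint_le _ (sqint_cst P 1)) => [|t]; first exact: mcY.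
  by rewrite normr1 clip_norm_le1.
have S2a : `|S2| <= a.
  apply: le_trans (ler_norm_sum _ _ _) _; apply: ler_sum => i _.
  apply: Enorm_le.
  - by apply: sqintM => //; apply: sqintB; exact: sfW.
  - by apply: sqintM => //; exact: sqint_norm.
  - move=> t; rewrite normrM ler_wpM2l//.
    apply: le_trans (stein_lipschitz ch h01 hn _ _) _.
    by rewrite (_ : _ - _ - _ = Y i t - clip (Y i t)) //; ring.
have SXra : `|SXr| <= a.
  apply: le_trans (ler_norm_sum _ _ _) _; apply: ler_sum => i _.
  apply: Enorm_le.
  - apply: sqintM => //; apply: sqintB => //.
    by apply: (sqint_le _ (sqint_cst P 1)) => [|t]; [exact: mcY|rewrite normr1 clip_norm_le1].
  - by apply: sqintM => //; exact: sqint_norm.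
  - by move=> t; rewrite normrM.
have Eg1 : `|\int[P]_t g (W t)| <= 1.
  rewrite -[leRHS](Ecst P 1); apply: Enorm_le; [exact: sqint_intg|exact: intg_cst|].
  by move=> t; exact: g1.
rewrite D WfW; move: Eg1; set G := \int[P]_t g (W t) => Eg1.
have GE : G = G * SXc + G * SXr by rewrite -mulrDr -XY mulr1.
rewrite (_ : _ - _ = (SXc * G - S1) + (G * SXr - S2)); last by rewrite {1}GE; ring.
apply: le_trans (ler_normD _ _) _; rewrite addrC lerD2r.
apply: le_trans (ler_normB _ _) _; rewrite mulr_natl mulr2n lerD//.
by rewrite normrM (le_trans _ SXra)// ler_piMl.
Qed.

Let Rintegral_theta_le (r : R -> R) (B : R -> R) : wint r -> wint B ->
  (forall x, `|r x| <= B x) ->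
  `|\int[mu]_(x in window R) r x| <= \int[mu]_(x in window R) B x.
Proof.
move=> ir iB rB; apply: le_trans (le_normr_Rintegral measurable_window ir) _.
by apply: le_Rintegral => //; exact: integrable_norm.
Qed.

(** Suited to p <= 3: the fluctuation term uses |g| <= 1 only. *)
Lemma ramp_error_rough lam : 0 < lam ->
  `|\int[P]_t h (W t) - N| <= 2 * a + M * b / 2 + lam + kappa * v1 / (2 * lam).
Proof.
move=> l0; apply: (le_trans stein_decomposition); rewrite -!addrA lerD2l !addrA.
have [im em] := window_m; have [iv ev] := window_v; have [it et] := window_theta.
have i1 : wint (fun x => M * m x + lam / 2).
  by apply: wintD; [exact: wintZ|exact: wint_cst].
apply: (le_trans (Rintegral_theta_le it _ (fun x => theta_le_rough x l0))).
  by apply: wintD => //; exact: wintZ.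
rewrite RintegralD//; last exact: wintZ.
rewrite RintegralD//; [|exact: wintZ|exact: wint_cst].
rewrite Rintegral_window_cst !RintegralZl// em ev le_eqVlt; apply/orP; left; apply/eqP.
by field; rewrite gt_eqF.
Qed.

(** Suited to p >= 3: lam' weighs the contribution of g(W), and lam, eps weigh
    the increments of g. *)
Lemma ramp_error_fine lam eps lam' : 0 < lam -> 0 < eps -> 0 < lam' ->
  `|\int[P]_t h (W t) - N| <= 2 * a + M * b / 2 + (lam' / 2 + kappa * v2 / (2 * lam')) +
    (lam * ((226 / 100) ^+ 2 + 81 / 100) + 2 * eps * (81 / 200 * al + 2 * delta)) / 2 +
    kappa / 2 * (v2 / (2 * lam) + v1 / eps).
Proof.
move=> l0 e0 l'0; apply: (le_trans stein_decomposition); rewrite -!addrA lerD2l !addrA.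
have [im em] := window_m; have [iv ev] := window_v; have [ivx evx] := window_vx.
have [it et] := window_theta; have [ie ee] := window_eta.
have -> : \int[mu]_(x in window R) theta x =
    \int[mu]_(x in window R) (theta x + eta x) - \int[mu]_(x in window R) eta x.
  by rewrite (@RintegralD _ _ _ mu (window R) theta eta)// addrK.
apply: (le_trans (ler_normB _ _)).
have H x : `|theta x + eta x| <= M * m x + (lam * (226 / 100) ^+ 2 / 2 * `|x| +
   ((lam * (81 / 200) + eps * (81 / 200 * al + 2 * delta)) / 2 +
   (kappa / (2 * lam) * vx x + kappa / (2 * eps) * v x))).
  apply: (le_trans (theta_le_fine x l0 e0)); rewrite le_eqVlt; apply/orP; left; apply/eqP.
  by field; rewrite !gt_eqF.
have i4 : wint (fun x => kappa / (2 * lam) * vx x + kappa / (2 * eps) * v x).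
  by apply: wintD; exact: wintZ.
have i3 : wint (fun x => (lam * (81 / 200) + eps * (81 / 200 * al + 2 * delta)) / 2 +
   (kappa / (2 * lam) * vx x + kappa / (2 * eps) * v x)).
  by apply: wintD => //; exact: wint_cst.
have i2 : wint (fun x => lam * (226 / 100) ^+ 2 / 2 * `|x| +
   ((lam * (81 / 200) + eps * (81 / 200 * al + 2 * delta)) / 2 +
   (kappa / (2 * lam) * vx x + kappa / (2 * eps) * v x))).
  by apply: wintD => //; apply: wintZ; exact: wint_norm.
apply: (le_trans (lerD (Rintegral_theta_le (wintD it ie) _ H) (eta_le l'0))).
  by apply: wintD => //; exact: wintZ.
rewrite RintegralD//; last exact: wintZ.
rewrite RintegralD//; last by apply: wintZ; exact: wint_norm.
rewrite RintegralD//; last exact: wint_cst.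
rewrite RintegralD//; [|exact: wintZ|exact: wintZ].
rewrite Rintegral_window_cst (RintegralZl _ _ im)// (RintegralZl _ _ iv)//
  (RintegralZl _ _ ivx)// (RintegralZl _ _ wint_norm)// em ev evx Rintegral_window_norm.
rewrite le_eqVlt; apply/orP; left; apply/eqP.
by field; rewrite !gt_eqF.
Qed.

End fixed_ramp.

Let F_le_ramp z al : 0 < al -> F z <= \int[P]_t ramp z al (W t).
Proof.
move=> al0; apply: Ele.
- by apply: intg_bool; exact: measurable_fun_ler.
- apply: (intg_le _ (intg_cst P 1)) => [|t].
    by apply: measurableT_comp => //; apply: continuous_measurable_fun; exact: ramp_continuous.
  by have /andP[? ?] := ramp01 z al (W t); rewrite normr1 ger0_norm.
- move=> t; case: ifPn => [/(ramp_left al0) -> //|_].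
  by have /andP[] := ramp01 z al (W t).
Qed.

Let ramp_le_F z al : 0 < al -> \int[P]_t ramp (z - al) al (W t) <= F z.
Proof.
move=> al0; apply: Ele.
- apply: (intg_le _ (intg_cst P 1)) => [|t].
    by apply: measurableT_comp => //; apply: continuous_measurable_fun; exact: ramp_continuous.
  by have /andP[? ?] := ramp01 (z - al) al (W t); rewrite normr1 ger0_norm.
- by apply: intg_bool; exact: measurable_fun_ler.
- move=> t; case: ifPn => [_|]; first by have /andP[] := ramp01 (z - al) al (W t).
  by rewrite -ltNge => /ltW zW; rewrite ramp_right// subrK.
Qed.

(** The indicator of ]-oo, z] lies between the ramps starting at z - al and at z,
    and Phi grows by at most 81/200 al over a length al. *)
Lemma kolmogorov_of_ramp al B : 0 < al ->
  (forall z, `|\int[P]_t ramp z al (W t) - normal_mean (ramp z al)| <= B) ->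
  forall z, `|F z - Phi z| <= 81 / 200 * al + B.
Proof.
move=> al0 HB z.
have a1 := F_le_ramp z al0; have a2 := ramp_le_F z al0.
have b1 := normal_mean_ramp_le z al0; have b2 := normal_mean_ramp_ge (z - al) al0.
have c1 : Phi (z + al) - Phi z <= 81 / 200 * (z + al - z).
  by apply: Phi_increment; rewrite lerDl ltW.
have c2 : Phi z - Phi (z - al) <= 81 / 200 * (z - (z - al)).
  by apply: Phi_increment; rewrite gerBl ltW.
have := HB z; have := HB (z - al); rewrite !ler_norml => /andP[d1 d2] /andP[d3 d4].
by apply/andP; split; lra.
Qed.

End core.

(** * Solving the recursive inequality for the distance *)

Section closing_arithmetic.
Variable R : realFieldType.
Implicit Types (c delta be s a b v w kappa : R).

(** Allows dividing by the moment sums, which may vanish. *)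
Lemma bound_perturbation delta be s c :
  0 <= c ->
  (forall eta, 0 < eta -> delta <= c * (be + eta) + 5 / 2 * (s + eta)) ->
  delta <= c * be + 5 / 2 * s.
Proof.
move=> c0 H; apply/ler_addgt0Pr => e e0.
have k0 : 0 < c + 5 / 2 by lra.
have ek : 0 < e / (c + 5 / 2) by rewrite divr_gt0.
apply: (le_trans (H _ ek)); rewrite le_eqVlt; apply/orP; left; apply/eqP.
by field; rewrite gt_eqF//; lra.
Qed.

(** The width 20 be makes the coefficient of delta on the right equal to 1/30;
    with the weight 7/10 s the remaining terms add up to less than
    11 be + 3/2 s. *)
Lemma rough_bound_solve delta be s a b (v1 : R) kappa :
  0 < be -> 0 < s -> 0 <= delta ->
  a <= 2 / 3 * be -> b <= 2 / 3 * be -> kappa * v1 <= s ^+ 2 ->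
  delta <= 81 / 200 * (20 * be) +
    (2 * a + (226 / 100 + 81 / 100 + 2 * delta / (20 * be)) * b / 2 +
     7 / 10 * s + kappa * v1 / (2 * (7 / 10 * s))) ->
  delta <= 13 * be + 5 / 2 * s.
Proof.
move=> be0 s0 d0 ha hb hv.
have h1 : 2 * delta / (20 * be) * b / 2 <= delta / 30.
  apply: (@le_trans _ _ (delta / (20 * be) * (2 / 3 * be))); last first.
    by rewrite le_eqVlt; apply/orP; left; apply/eqP; field; rewrite gt_eqF.
  rewrite (_ : _ * b / 2 = delta / (20 * be) * b); last by field; rewrite gt_eqF.
  by rewrite ler_wpM2l// divr_ge0// mulr_ge0// ltW.
have h2 : kappa * v1 / (2 * (7 / 10 * s)) <= 5 / 7 * s.
  rewrite ler_pdivrMr; last by rewrite !mulr_gt0// ?divr_gt0.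
  apply: le_trans hv _; rewrite expr2; lra.
have -> : (226 / 100 + 81 / 100 + 2 * delta / (20 * be)) * b / 2 =
  (307 / 200) * b + 2 * delta / (20 * be) * b / 2.
  by field; rewrite gt_eqF.
lra.
Qed.

(** The terms of delta on the right have coefficients 53/1500, from the width
    15 be, and 9/125, from eps = 9/250.  The weights 4/5 s and 5/21 s nearly
    minimise the terms in s; after division by 1 - 53/1500 - 9/125 their sum is
    just below 5/2 s. *)
Lemma fine_bound_solve delta be s a b (v1 v2 : R) kappa :
  0 < be -> 0 < s -> 0 <= delta -> 0 <= kappa ->
  a <= 53 / 100 * be -> b <= 53 / 100 * be -> v1 <= 53 / 100 * be ->
  kappa * v2 <= 2 / 3 * s ^+ 2 ->
  delta <= 81 / 200 * (15 * be) +
    (2 * a + (226 / 100 + 81 / 100 + 2 * delta / (15 * be)) * b / 2 +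
     (4 / 5 * s / 2 + kappa * v2 / (2 * (4 / 5 * s))) +
     (5 / 21 * s * ((226 / 100) ^+ 2 + 81 / 100) +
      2 * (9 / 250) * (81 / 200 * (15 * be) + 2 * delta)) / 2 +
     kappa / 2 * (v2 / (2 * (5 / 21 * s)) + v1 / (9 / 250))) ->
  delta <= (109 / 10 + 46 / 5 * kappa) * be + 5 / 2 * s.
Proof.
move=> be0 s0 d0 k0 ha hb hv1 hv2.
have h1 : 2 * delta / (15 * be) * b / 2 <= delta * (53 / 1500).
  apply: (@le_trans _ _ (delta / (15 * be) * (53 / 100 * be))); last first.
    by rewrite le_eqVlt; apply/orP; left; apply/eqP; field; rewrite gt_eqF.
  rewrite (_ : _ * b / 2 = delta / (15 * be) * b); last by field; rewrite gt_eqF.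
  by rewrite ler_wpM2l// divr_ge0// mulr_ge0// ltW.
have h2 : kappa * v2 / (2 * (4 / 5 * s)) <= 5 / 12 * s.
  rewrite ler_pdivrMr; last by rewrite !mulr_gt0// ?divr_gt0.
  apply: le_trans hv2 _; rewrite expr2; lra.
have h3 : kappa / 2 * (v2 / (2 * (5 / 21 * s)) + v1 / (9 / 250)) <=
    7 / 10 * s + 7362 / 1000 * (kappa * be).
  rewrite mulrDr; apply: lerD.
    rewrite (_ : _ * (v2 / _) = kappa * v2 / (4 * (5 / 21 * s))); last first.
      by field; rewrite gt_eqF.
    rewrite ler_pdivrMr; last by rewrite !mulr_gt0// ?divr_gt0.
    apply: le_trans hv2 _; rewrite expr2; lra.
  have := ler_wpM2l k0 hv1; have : 0 <= kappa * be by rewrite mulr_ge0// ltW.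
  lra.
have -> : (226 / 100 + 81 / 100 + 2 * delta / (15 * be)) * b / 2 =
  (307 / 200) * b + 2 * delta / (15 * be) * b / 2.
  by field; rewrite gt_eqF.
have : 0 <= kappa * be by rewrite mulr_ge0// ltW.
rewrite mulrDl -mulrA; lra.
Qed.

(** Apply X^3 + 2 y^3 - 3 X y^2 = (X - y)^2 (X + 2 y) >= 0 to X = 126/100 x; the
    factor 126/100, close to the cube root of 2, balances the two cubes. *)
Lemma mul_sqr_le_cube (x y : R) : 0 <= x -> 0 <= y ->
  x * y ^+ 2 <= 53 / 100 * (x ^+ 3 + y ^+ 3).
Proof.
move=> x0 y0.
have : 0 <= (126 / 100 * x - y) ^+ 2 * (126 / 100 * x + 2 * y).
  by rewrite mulr_ge0 ?sqr_ge0// addr_ge0 ?mulr_ge0.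
have := exprn_ge0 3 x0; have := exprn_ge0 3 y0.
rewrite (_ : (126 / 100 * x - y) ^+ 2 * (126 / 100 * x + 2 * y) =
  (126 / 100) ^+ 3 * x ^+ 3 + 2 * y ^+ 3 - 3 * (126 / 100) * (x * y ^+ 2)); last by ring.
lra.
Qed.

End closing_arithmetic.

(** * Pointwise inequalities between truncated products and powers *)

Section pointwise.
Variable R : realType.
Implicit Types (x y s t : R).

(** Young's inequality with exponents (s + t) / s and (s + t) / t. *)
Lemma powR_mul_le x y s t : 0 <= x -> 0 <= y -> 0 < s -> 0 < t ->
  x `^ s * y `^ t <= s / (s + t) * x `^ (s + t) + t / (s + t) * y `^ (s + t).
Proof.
move=> x0 y0 s0 t0; have st0 : 0 < s + t by rewrite addr_gt0.
have := @conjugate_powR R (x `^ s) (y `^ t) ((s + t) / s) ((s + t) / t).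
rewrite -!powRrM (_ : s * _ = s + t); last by field; rewrite gt_eqF.
rewrite (_ : t * _ = s + t); last by field; rewrite gt_eqF.
rewrite !invf_div ![_ / (s + t) * _]mulrC; apply; rewrite ?powR_ge0 ?divr_gt0//.
by rewrite -mulrDl divff// gt_eqF.
Qed.

Lemma powR_le_add1 x s t : 0 <= x -> 0 <= s -> s <= t -> x `^ s <= 1 + x `^ t.
Proof.
move=> x0 s0 st; have [x1|/ltW x1] := leP 1 x.
  by apply: (le_trans (ler_powR x1 st)); rewrite lerDr.
apply: (@le_trans _ _ 1); last by rewrite lerDl powR_ge0.
by have := ge0_ler_powR s0 x0 ler01 x1; rewrite powR1.
Qed.

Lemma clip_norm_le y : `|clip y| <= `|y|.
Proof.
have h1 := ler_norm y; have h2 := ler_norm (- y); rewrite normrN in h2.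
have h0 := normr_ge0 y; rewrite ler_norml /clip; apply/andP; split.
  rewrite le_max le_min; apply/orP.
  have [y0|y0] := leP 0 y; [right; apply/andP; split; lra|].
  by right; apply/andP; split; lra.
rewrite ge_max ge_min; apply/andP; split; first lra.
by apply/orP; right.
Qed.

(** |clip y| is at most both 1 and |y|, so lowering the exponent n to s increases
    the power of the former and then |y| can replace it. *)
Lemma clip_expr_le n y s : 0 < s -> s <= n%:R -> `|clip y| ^+ n <= `|y| `^ s.
Proof.
move=> s0 sn; have [->|c0] := eqVneq (clip y) 0.
  case: n sn => [|n _]; first by move=> /(lt_le_trans s0); rewrite ltxx.
  by rewrite normr0 expr0n powR_ge0.
rewrite -powR_mulrn//; apply: (@le_trans _ _ (`|clip y| `^ s)).
  by apply: ger_powR => //; rewrite normr_gt0 c0 clip_norm_le1.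
by apply: ge0_ler_powR; rewrite ?nnegrE//; [exact: ltW|exact: clip_norm_le].
Qed.

(** The left-hand side vanishes unless |y| > 1. *)
Lemma sub_clip_le y s : 1 <= s -> `|y - clip y| <= `|y| `^ s.
Proof.
move=> s1; have [y1|y1] := leP `|y| 1.
  suff -> : clip y = y by rewrite subrr normr0 powR_ge0.
  move: y1; rewrite ler_norml => /andP[y1 y2].
  by rewrite /clip (min_idPr y2) (max_idPr y1).
apply: (@le_trans _ _ `|y|); last exact/le1r_powR/s1/ltW.
move: y1; have [y0|y0] := leP 0 y; rewrite ?(ger0_norm y0) ?(ltr0_norm y0) => y1.
  rewrite /clip (min_idPl (ltW y1)) max_r; last lra.
  by rewrite ger0_norm; lra.
rewrite /clip min_r ?max_l; [|lra|lra].
by rewrite ltr0_norm; lra.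
Qed.

Section rough.
Variable p : R.
Hypotheses (p2 : 2 < p) (p3 : p <= 3).

Let young1 x y : `|x| * `|y| `^ (p - 1) <= 2 / 3 * (`|x| `^ p + `|y| `^ p).
Proof.
have := @powR_mul_le `|x| `|y| 1 (p - 1) (normr_ge0 _) (normr_ge0 _) ltr01.
rewrite powRr1// (_ : 1 + (p - 1) = p); last by ring.
move=> H; apply: le_trans (H _) _; first by move: p2; lra.
rewrite mulrDr lerD// ler_wpM2r ?powR_ge0// ler_pdivrMr; move: p2 p3; lra.
Qed.

Lemma rough_tail x y : `|x| * `|y - clip y| <= 2 / 3 * (`|x| `^ p + `|y| `^ p).
Proof.
apply: le_trans (young1 x y); rewrite ler_wpM2l// sub_clip_le//; move: p2; lra.
Qed.

Lemma rough_square x y : `|x| * clip y ^+ 2 <= 2 / 3 * (`|x| `^ p + `|y| `^ p).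
Proof.
apply: le_trans (young1 x y); rewrite ler_wpM2l// -(real_normK (num_real _)).
by rewrite clip_expr_le//; move: p2 p3; lra.
Qed.

Lemma rough_variance x y : x ^+ 2 * `|clip y| <= `|x| `^ p + `|y| `^ p.
Proof.
have p20 : 0 < p - 2 by move: p2; lra.
apply: (@le_trans _ _ (`|x| `^ 2 * `|y| `^ (p - 2))).
  rewrite -(real_normK (num_real x)) -(@powR_mulrn _ `|x|)// ler_wpM2l ?powR_ge0//.
  by rewrite -[leLHS]expr1 clip_expr_le//; move: p3; lra.
apply: (le_trans (powR_mul_le _ _ _ _)) => //.
rewrite (_ : 2 + (p - 2) = p); last by ring.
by apply: lerD; rewrite ler_piMl ?powR_ge0// ler_pdivrMr; move: p2; lra.
Qed.

End rough.

Let norm3 x : `|x| `^ 3 = `|x| ^+ 3.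
Proof. by rewrite -powR_mulrn. Qed.

Lemma cubic_tail x y : `|x| * `|y - clip y| <= 53 / 100 * (`|x| `^ 3 + `|y| `^ 3).
Proof.
rewrite !norm3; apply: le_trans (mul_sqr_le_cube _ _) => //.
by rewrite ler_wpM2l// -powR_mulrn// sub_clip_le//; lra.
Qed.

Lemma cubic_square x y : `|x| * clip y ^+ 2 <= 53 / 100 * (`|x| `^ 3 + `|y| `^ 3).
Proof.
rewrite !norm3; apply: le_trans (mul_sqr_le_cube _ _) => //.
rewrite ler_wpM2l// -(real_normK (num_real _)) -(@powR_mulrn _ `|y|)//.
by rewrite clip_expr_le.
Qed.

Lemma cubic_variance x y : x ^+ 2 * `|clip y| <= 53 / 100 * (`|x| `^ 3 + `|y| `^ 3).
Proof.
rewrite !norm3 addrC; apply: le_trans (mul_sqr_le_cube _ _) => //.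
by rewrite mulrC -(real_normK (num_real x)) ler_wpM2r ?exprn_ge0// clip_norm_le.
Qed.

Lemma fine_variance p x y : 3 <= p -> p <= 4 ->
  x ^+ 2 * clip y ^+ 2 <= 2 / 3 * (`|x| `^ p + `|y| `^ p).
Proof.
move=> p3 p4; have p20 : 0 < p - 2 by lra.
apply: (@le_trans _ _ (`|x| `^ 2 * `|y| `^ (p - 2))).
  rewrite -(real_normK (num_real x)) -(@powR_mulrn _ `|x|)// ler_wpM2l ?powR_ge0//.
  by rewrite -(real_normK (num_real (clip y))) clip_expr_le//; lra.
apply: (le_trans (powR_mul_le _ _ _ _)) => //.
rewrite (_ : 2 + (p - 2) = p); last by ring.
by rewrite mulrDr; apply: lerD; rewrite ler_wpM2r ?powR_ge0// ler_pdivrMr; lra.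
Qed.

(** Young's inequality, with a scale u to be chosen; for p = 3 it is an equality. *)
Lemma cube_powR_le p u x : 3 <= p -> 0 < u -> 0 <= x ->
  x `^ 3 * u `^ (p - 3) <= 3 / p * x `^ p + (p - 3) / p * u `^ p.
Proof.
move=> p3 u0 x0; have [p_eq|p_ne] := eqVneq p 3.
  by rewrite p_eq subrr powRr0 mul0r mul0r addr0 divff// mulr1 mul1r.
have p30 : 0 < p - 3 by rewrite subr_gt0 lt_neqAle eq_sym p_ne.
have := @powR_mul_le x u 3 (p - 3) x0 (ltW u0) (ltr0n _ 3) p30.
by rewrite (_ : 3 + (p - 3) = p)//; ring.
Qed.

(** 2^(1 - 3/p) increases with p, and (119/200)^4 > 1/8. *)
Lemma two_powR_le p : 0 < p -> p <= 4 -> 2 * (2 `^ (- p^-1)) `^ 3 <= 119 / 100 :> R.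
Proof.
move=> p0 p4; rewrite -powRrM.
apply: (@le_trans _ _ (2 * 2 `^ (- (3 / 4)))).
  rewrite ler_wpM2l// ler_powR ?ler1n// mulNr lerN2 mulrC ler_wpM2r//.
  by rewrite lef_pV2 ?posrE.
suff : 2 `^ (- (3 / 4)) <= 119 / 200 :> R by lra.
have pw : (2 `^ (- (3 / 4)) : R) ^+ 4 = 8^-1.
  rewrite -powR_mulrn ?powR_ge0// -powRrM (_ : - (3 / 4) * 4 = - 3); last by field.
  by rewrite powR_invn ?ler0n//; field.
rewrite leNgt; apply/negP => H.
have : (119 / 200 : R) ^+ 4 < (2 `^ (- (3 / 4))) ^+ 4.
  by rewrite ltrXn2r ?nnegrE ?powR_ge0//; lra.
rewrite pw; lra.
Qed.

End pointwise.

(** * The distance in terms of moments *)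

Section closing.
Context {d : measure_display} {T : measurableType d} {R : realType}.
Variable P : probability T R.
Context {J : finType}.
Variables X Y : J -> T -> R.
Variables kappa delta : R.
Let W (t : T) := \sum_i X i t.
Let F z := \int[P]_t (if W t <= z then 1 else 0).

Hypotheses (sX : forall i, sqint P (X i)) (sY : forall i, sqint P (Y i)).
Hypothesis orthogonal : forall i (f : R -> R), continuous f ->
  (exists C : R, forall x, `|f x| <= C) -> \int[P]_t (X i t * f (W t - Y i t)) = 0.
Hypothesis sumXY : \sum_i \int[P]_t (X i t * Y i t) = 1.
Hypothesis EW2 : \int[P]_t (W t ^+ 2) = 1.
Hypothesis variance_le : forall g : R -> R, measurable_fun setT g ->
  (forall y, `|g y| <= 1) ->
  \int[P]_t ((\sum_i X i t * g (Y i t) - \int[P]_t (\sum_i X i t * g (Y i t))) ^+ 2) <=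
  kappa * \sum_i \int[P]_t ((X i t * g (Y i t)) ^+ 2).
Hypothesis deltaP : forall z, `|F z - Phi z| <= delta.
Hypothesis delta_least : forall B, (forall z, `|F z - Phi z| <= B) -> delta <= B.
Hypothesis kappa0 : 0 <= kappa.

Definition moment_sum (r : R) :=
  \sum_i (\int[P]_t (`|X i t| `^ r) + \int[P]_t (`|Y i t| `^ r)).

Lemma moment_sum_ge0 r : 0 <= moment_sum r.
Proof.
by apply: sumr_ge0 => i _; apply: addr_ge0; apply: Rintegral_ge0 => t _;
  exact: powR_ge0.
Qed.

Let delta_ge0 : 0 <= delta.
Proof. exact: le_trans (normr_ge0 _) (deltaP 0). Qed.

Lemma sum_E_le (G : R -> R -> R) c r :
  measurable_fun setT (fun p : R * R => G p.1 p.2) ->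
  (forall i, intg P (fun t => `|X i t| `^ r)) ->
  (forall i, intg P (fun t => `|Y i t| `^ r)) ->
  (forall x y, 0 <= G x y <= c * (`|x| `^ r + `|y| `^ r)) ->
  \sum_i \int[P]_t G (X i t) (Y i t) <= c * moment_sum r.
Proof.
move=> mG iX iY GP; rewrite mulr_sumr; apply: ler_sum => i _.
have iXY : intg P (fun t => `|X i t| `^ r + `|Y i t| `^ r) by exact: intgD.
have iR := intgZ c iXY.
rewrite -ED// -EZ//; apply: Ele => //.
- apply: (intg_le _ iR) => [|t].
    apply: (@measurableT_comp _ _ _ _ _ _ (fun p : R * R => G p.1 p.2) setT
      (fun t => (X i t, Y i t))) => //.
    by apply: measurable_fun_pair; [exact: (sqint_measurable (sX i))
      |exact: (sqint_measurable (sY i))].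
  have /andP[G0 G1] := GP (X i t) (Y i t).
  by rewrite ger0_norm// ger0_norm// (le_trans G0).
- by move=> t; have /andP[] := GP (X i t) (Y i t).
Qed.

Let mclip : measurable_fun setT (fun p : R * R => clip p.2).
Proof. by apply: measurableT_comp; [exact: measurable_clip|exact: measurable_snd]. Qed.

Let mtail : measurable_fun setT (fun p : R * R => `|p.1| * `|p.2 - clip p.2|).
Proof.
apply: measurable_funM; apply: measurableT_comp => //.
by apply: measurable_funB => //; exact: measurable_snd.
Qed.

Let msquare : measurable_fun setT (fun p : R * R => `|p.1| * clip p.2 ^+ 2).
Proof.
apply: measurable_funM; first exact: measurableT_comp.
exact: measurable_funX.
Qed.

Let mvar : measurable_fun setT (fun p : R * R => p.1 ^+ 2 * `|clip p.2|).
Proof.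
apply: measurable_funM; last exact: measurableT_comp.
by apply: measurable_funX; exact: measurable_fst.
Qed.

Let mvar2 : measurable_fun setT (fun p : R * R => p.1 ^+ 2 * clip p.2 ^+ 2).
Proof.
apply: measurable_funM; last exact: measurable_funX.
by apply: measurable_funX; exact: measurable_fst.
Qed.

Section rough.
Variable p : R.
Hypotheses (p2 : 2 < p) (p3 : p <= 3).
Hypothesis iX : forall i, intg P (fun t => `|X i t| `^ p).
Hypothesis iY : forall i, intg P (fun t => `|Y i t| `^ p).

Lemma kolmogorov_rough :
  delta <= 13 * moment_sum p + 5 / 2 * Num.sqrt (kappa * moment_sum p).
Proof.
apply: bound_perturbation => // eta eta0.
have b0 := moment_sum_ge0 p.
have be0 : 0 < moment_sum p + eta by rewrite ltr_wpDl.
have s0 : 0 < Num.sqrt (kappa * moment_sum p) + eta by rewrite ltr_wpDl ?sqrtr_ge0.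
have al0 : 0 < 20 * (moment_sum p + eta) by rewrite mulr_gt0.
have lam0 : 0 < 7 / 10 * (Num.sqrt (kappa * moment_sum p) + eta) by rewrite mulr_gt0.
have H := kolmogorov_of_ramp sX al0
  (fun z => ramp_error_rough sX sY orthogonal sumXY EW2 variance_le deltaP z al0 lam0).
have {}H := delta_least H.
apply: (rough_bound_solve be0 s0 delta_ge0 _ _ _ H).
- apply: (@le_trans _ _ (2 / 3 * moment_sum p)); last by rewrite ler_wpM2l// lerDl ltW.
  apply: (sum_E_le (G := fun x y => `|x| * `|y - clip y|)) => // x y.
  by rewrite mulr_ge0//= rough_tail.
- apply: (@le_trans _ _ (2 / 3 * moment_sum p)); last by rewrite ler_wpM2l// lerDl ltW.
  apply: (sum_E_le (G := fun x y => `|x| * clip y ^+ 2)) => // x y.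
  by rewrite mulr_ge0 ?sqr_ge0//= rough_square.
- apply: (@le_trans _ _ (kappa * (1 * moment_sum p))).
    rewrite ler_wpM2l//.
    apply: (sum_E_le (G := fun x y => x ^+ 2 * `|clip y|)) => // x y.
    by rewrite mulr_ge0 ?sqr_ge0//= mul1r rough_variance.
  rewrite mul1r -{1}[kappa * _]sqr_sqrtr ?mulr_ge0// lerXn2r ?nnegrE ?sqrtr_ge0//.
    exact: ltW.
  by rewrite lerDl ltW.
Qed.

End rough.

Section fine.
Variable p : R.
Hypotheses (p3 : 3 <= p) (p4 : p <= 4).
Hypothesis iX3 : forall i, intg P (fun t => `|X i t| `^ 3).
Hypothesis iY3 : forall i, intg P (fun t => `|Y i t| `^ 3).
Hypothesis iX : forall i, intg P (fun t => `|X i t| `^ p).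
Hypothesis iY : forall i, intg P (fun t => `|Y i t| `^ p).

Lemma kolmogorov_fine :
  delta <= (109 / 10 + 46 / 5 * kappa) * moment_sum 3 +
    5 / 2 * Num.sqrt (kappa * moment_sum p).
Proof.
apply: bound_perturbation => [|eta eta0]; first by rewrite addr_ge0// mulr_ge0.
have b0 := moment_sum_ge0 3; have bp0 := moment_sum_ge0 p.
have be0 : 0 < moment_sum 3 + eta by rewrite ltr_wpDl.
have s0 : 0 < Num.sqrt (kappa * moment_sum p) + eta by rewrite ltr_wpDl ?sqrtr_ge0.
have al0 : 0 < 15 * (moment_sum 3 + eta) by rewrite mulr_gt0.
have lam0 : 0 < 5 / 21 * (Num.sqrt (kappa * moment_sum p) + eta) by rewrite mulr_gt0.
have lam'0 : 0 < 4 / 5 * (Num.sqrt (kappa * moment_sum p) + eta) by rewrite mulr_gt0.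
have eps0 : 0 < 9 / 250 :> R by rewrite divr_gt0.
have H := kolmogorov_of_ramp sX al0
  (fun z => ramp_error_fine sX sY orthogonal sumXY EW2 variance_le deltaP z al0 lam0 eps0 lam'0).
have {}H := delta_least H.
apply: (fine_bound_solve be0 s0 delta_ge0 kappa0 _ _ _ _ H).
- apply: (@le_trans _ _ (53 / 100 * moment_sum 3)); last by rewrite ler_wpM2l// lerDl ltW.
  apply: (sum_E_le (G := fun x y => `|x| * `|y - clip y|)) => // x y.
  by rewrite mulr_ge0//= cubic_tail.
- apply: (@le_trans _ _ (53 / 100 * moment_sum 3)); last by rewrite ler_wpM2l// lerDl ltW.
  apply: (sum_E_le (G := fun x y => `|x| * clip y ^+ 2)) => // x y.
  by rewrite mulr_ge0 ?sqr_ge0//= cubic_square.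
- apply: (@le_trans _ _ (53 / 100 * moment_sum 3)); last by rewrite ler_wpM2l// lerDl ltW.
  apply: (sum_E_le (G := fun x y => x ^+ 2 * `|clip y|)) => // x y.
  by rewrite mulr_ge0 ?sqr_ge0//= cubic_variance.
- apply: (@le_trans _ _ (kappa * (2 / 3 * moment_sum p))).
    rewrite ler_wpM2l//.
    apply: (sum_E_le (G := fun x y => x ^+ 2 * clip y ^+ 2)) => // x y.
    by rewrite mulr_ge0 ?sqr_ge0//= fine_variance.
  rewrite mulrCA ler_wpM2l//.
  rewrite -{1}[kappa * _]sqr_sqrtr ?mulr_ge0// lerXn2r ?nnegrE ?sqrtr_ge0//.
    exact: ltW.
  by rewrite lerDl ltW.
Qed.

End fine.

End closing.

(** * Consequences of local dependence *)

Section local_dependence.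
Context {d : measure_display} {T : measurableType d} {R : realType}.
Variable P : probability T R.

(** A variable with zero second moment is negligible; taking the weight in
    [E_amgm] large avoids speaking of almost sure equality. *)
Lemma E_mul_eq0 (U V : T -> R) : sqint P U -> sqint P V ->
  \int[P]_t (U t ^+ 2) = 0 -> \int[P]_t (U t * V t) = 0.
Proof.
move=> sU sV U0; apply/eqP; rewrite -normr_le0; apply/ler_addgt0Pr => e e0.
set C := \int[P]_t (V t ^+ 2).
have C0 : 0 <= C by apply: Rintegral_ge0 => t _; exact: sqr_ge0.
have C1 : 0 < C + 1 by rewrite ltr_wpDl.
have m0 : 0 < (C + 1) / (2 * e) by rewrite divr_gt0// mulr_gt0.
apply: (le_trans (E_amgm m0 sU sV)); rewrite U0 mulr0 !add0r -/C.
rewrite (_ : (2 * _)^-1 = e / (C + 1)); last by field; rewrite !gt_eqF.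
rewrite mulrAC ler_pdivrMr// ler_wpM2l//; first exact: ltW.
by rewrite lerDl.
Qed.

Lemma varianceE_Rintegral (U : {RV P >-> R}) :
  ('V_P[U] = \int[P]_t ((U t - Rintegral P setT U) ^+ 2)%R%:E)%E.
Proof.
rewrite /variance covariance.unlock expectation.unlock; apply: eq_integral => t _ /=.
by rewrite expr2.
Qed.

Lemma sqint_of_variance (U : {RV P >-> R}) :
  ('E_P[U] = 0)%E -> ('V_P[U] < +oo)%E -> sqint P U.
Proof.
move=> EU; rewrite varianceE_Rintegral.
have -> : \int[P]_t U t = 0 by move: EU; rewrite expectation.unlock /Rintegral => ->.
move=> VU; split => //; apply/integrableP; split.
  by apply/measurable_EFinP; exact: measurable_funX.
apply: le_lt_trans VU; rewrite le_eqVlt; apply/orP; left; apply/eqP.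
by apply: eq_integral => t _ /=; rewrite subr0 ger0_norm// sqr_ge0.
Qed.

Context {J : finType}.
Variable X : J -> {RV P >-> R}.
Hypothesis sX : forall i, sqint P (X i).
Hypothesis EX : forall i, \int[P]_t X i t = 0.
Variables A B : J -> {set J}.
Hypothesis subAB : forall i, A i \subset B i.
Hypothesis indepX : forall i, indep_subfamilies X [set i]%SET (~: A i)%SET.
Hypothesis indepA : forall i, indep_subfamilies X (A i) (~: B i)%SET.

Let Y i t := \sum_(j in A i) X j t.
Let W t := \sum_i X i t.

Let sumC i t : W t - Y i t = \sum_(j in (~: A i)%SET) X j t.
Proof.
rewrite /W (bigID (mem (A i)))/= addrAC subrr add0r.
by apply: eq_bigl => j; rewrite inE.
Qed.

Lemma sqint_local_sum i : sqint P (Y i).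
Proof. exact: sqint_sum. Qed.

Let E_X_rest i (f : R -> R) : measurable_fun setT f ->
  intg P (fun t => f (W t - Y i t)) -> intg P (fun t => X i t * f (W t - Y i t)) ->
  \int[P]_t (X i t * f (W t - Y i t)) = 0.
Proof.
move=> mf i1 i2.
rewrite (indep_subfamilies_E_mul (@indepX i) _ _ _ _ _ i1 i2) ?EX ?mul0r//.
- exact: intg_measurable i1.
- by apply: family_measurable_X; rewrite inE.
- rewrite (_ : (fun t => _) = (fun t => f (\sum_(j in (~: A i)%SET) X j t))).
    exact: family_measurable_sum.
  by apply/funext => t; rewrite sumC.
- exact: sqint_intg.
Qed.

Let sWY i : sqint P (fun t => W t - Y i t).
Proof. by apply: sqintB; exact: sqint_sum. Qed.

(** W - Y_i is the sum of the X_j with j outside A_i, hence independent of the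
    centred variable X_i. *)
Lemma local_orthogonal i (f : R -> R) : continuous f ->
  (exists C : R, forall x, `|f x| <= C) -> \int[P]_t (X i t * f (W t - Y i t)) = 0.
Proof.
move=> cf [C fC]; have mf := continuous_measurable_fun cf.
have mfW : measurable_fun setT (fun t => f (W t - Y i t)).
  by apply: measurableT_comp => //; exact: sqint_measurable (sWY i).
apply: E_X_rest => //.
  apply: (intg_le mfW (intg_cst P C)) => t.
  exact: le_trans (fC _) (ler_norm _).
exact: (sqintMb_intg mfW (fun t => fC _) (sX i)).
Qed.

Lemma local_sum_XY : \int[P]_t (W t ^+ 2) = 1 ->
  \sum_i \int[P]_t (X i t * Y i t) = 1.
Proof.
move=> <-; have sW : sqint P W by exact: sqint_sum.
rewrite (@eq_Rintegral _ _ _ _ _ (fun t => \sum_i X i t * W t)); last first.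
  by move=> t _; rewrite expr2 -mulr_suml.
rewrite Esum; last by move=> i; exact: sqintM.
apply: eq_bigr => i _.
transitivity (\int[P]_t (X i t * Y i t + X i t * (W t - Y i t))).
  rewrite ED; [|exact: (sqintM (sX i) (sqint_local_sum i))
               |exact: (sqintM (sX i) (sWY i))].
  rewrite (E_X_rest (f := id)) ?addr0//.
  - exact: sqint_intg.
  - exact: sqintM.
by apply: eq_Rintegral => t _; ring.
Qed.

(** In this degenerate case X_i is independent of itself. *)
Lemma E_sqr_not_local i : i \notin A i -> \int[P]_t (X i t ^+ 2) = 0.
Proof.
move=> iA; under eq_Rintegral do rewrite expr2.
rewrite (indep_subfamilies_E_mul (@indepX i)) ?EX ?mul0r//.
- by apply: family_measurable_X; rewrite inE.
- by apply: family_measurable_X; rewrite inE.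
- exact: sqint_intg.
- exact: sqint_intg.
- exact: sqintM.
Qed.

(** Some E X_i Y_i is nonzero, so i belongs to A_i, hence to B_i, and i is a
    neighbour of itself. *)
Lemma local_kappa_ge1 (kappa : R) :
  (forall i, #|neighbours B i|%:R <= kappa) ->
  \sum_i \int[P]_t (X i t * Y i t) = 1 -> 1 <= kappa.
Proof.
move=> card_nbr S1; case: (pickP (fun i => i \in A i)) => [i iA|nA].
  apply: le_trans (card_nbr i); rewrite ler1n; apply/card_gt0P; exists i.
  rewrite inE finset.setIid; apply/finset.set0Pn; exists i.
  exact: (fintype.subsetP (subAB i)).
have : (0 : R) = 1.
  rewrite -S1 big1// => i _; apply: E_mul_eq0 => //; first exact: sqint_local_sum.
  by apply: E_sqr_not_local; rewrite nA.
by move=> /eqP; rewrite eq_sym oner_eq0.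
Qed.

(** If B_j does not meet B_i then A_j lies in the complement of B_i, so that
    X_i g(Y_i) and X_j g(Y_j) are functions of independent subfamilies.  This
    requires i in A_i and j in A_j; otherwise one of the two variables is
    negligible. *)
Lemma local_variance_le (kappa : R) (g : R -> R) :
  (forall i, #|neighbours B i|%:R <= kappa) ->
  measurable_fun setT g -> (forall y, `|g y| <= 1) ->
  \int[P]_t ((\sum_i X i t * g (Y i t) - \int[P]_t (\sum_i X i t * g (Y i t))) ^+ 2) <=
  kappa * \sum_i \int[P]_t ((X i t * g (Y i t)) ^+ 2).
Proof.
move=> card_nbr mg g1.
have mgY i : measurable_fun setT (fun t => g (Y i t)).
  by apply: measurableT_comp => //; exact: sqint_measurable (sqint_local_sum i).
have sZ i : sqint P (fun t => X i t * g (Y i t)).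
  exact: (sqintMb (mgY i) (fun t => g1 _) (sX i)).
apply: (E_sqr_sum_local (Z := fun i t => X i t * g (Y i t)) sZ (nb := neighbours B)) => //.
  by move=> i j; rewrite !inE finset.setIC.
have sg i : sqint P (fun t => g (Y i t)).
  by apply: (sqint_le (mgY i) (sqint_cst P 1)) => t; rewrite normr1.
have degenerate i j : i \notin A i ->
    \int[P]_t (X i t * g (Y i t) * (X j t * g (Y j t))) =
    \int[P]_t (X i t * g (Y i t)) * \int[P]_t (X j t * g (Y j t)).
  move=> iA; have X0 := E_sqr_not_local iA.
  rewrite (E_mul_eq0 (sX i) (sg i) X0) mul0r.
  under eq_Rintegral do rewrite -mulrA; apply: E_mul_eq0 => //.
  have := sqintMb (mgY i) (fun t => g1 _) (sZ j).
  by under eq_fun do rewrite mulrC.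
move=> i j; rewrite inE negbK => /eqP BB.
case: (boolP (i \in A i)) => [iA|]; last exact: degenerate.
case: (boolP (j \in A j)) => [jA|jA]; last first.
  rewrite mulrC -(degenerate _ _ jA); apply: eq_Rintegral => t _.
  by rewrite mulrC.
have mG : measurable_fun setT (fun p : R * R => p.1 * g p.2).
  apply: measurable_funM; first exact: measurable_fst.
  by apply: measurableT_comp => //; exact: measurable_snd.
apply: (indep_subfamilies_E_mul (@indepA i)).
- exact: sqint_measurable (sZ i).
- exact: sqint_measurable (sZ j).
- exact: (family_measurable_comp2 (X := X) iA mG).
- apply: (@family_measurableS _ _ _ _ _ _ (A j)).
    apply: (fintype.subset_trans (subAB j)); apply/fintype.subsetP => k kB.
    rewrite inE; apply/negP => kB'.
    have : k \in B j :&: B i by rewrite inE kB.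
    by rewrite BB inE.
  exact: (family_measurable_comp2 (X := X) jA mG).
- exact: sqint_intg.
- exact: sqint_intg.
- exact: sqintM.
Qed.

End local_dependence.

(** * The Kolmogorov distance and absolute moments as real numbers *)

Section distance.
Context {d : measure_display} {T : measurableType d} {R : realType}.
Variable P : probability T R.
Local Notation mu := (@lebesgue_measure R).

Lemma cdfE (W : {RV P >-> R}) z :
  cdf W z = (\int[P]_t (if W t <= z then 1 else 0))%:E.
Proof.
have mA : measurable (W @^-1` `]-oo, z]) by rewrite -[_ @^-1` _]setTI; exact: measurable_funP.
rewrite /cdf /distribution /pushforward /= /Rintegral.
rewrite (_ : (\int[P]_t _)%E = P (W @^-1` `]-oo, z])).
  by rewrite fineK// fin_num_measure.
rewrite -(setIT (W @^-1` _)) -integral_indic//; apply: eq_integral => t _.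
rewrite indicE; congr (_%:E); case: ifPn => Wz.
  by rewrite mem_set//= in_itv.
by rewrite memNset//= in_itv/= (negbTE Wz).
Qed.

Lemma normal_cdfE (z : R) : normal_cdf z = (Phi z)%:E.
Proof.
rewrite /normal_cdf /normal_prob /Phi /Rintegral fineK//.
by apply: integrable_fin_num => //; exact: phi_integrableS.
Qed.

Lemma normal_distanceE (W : {RV P >-> R}) : exists delta : R,
  [/\ normal_distance W = delta%:E,
      forall z, `|\int[P]_t (if W t <= z then 1 else 0) - Phi z| <= delta &
      forall B, (forall z, `|\int[P]_t (if W t <= z then 1 else 0) - Phi z| <= B) ->
        delta <= B].
Proof.
pose D z := `|\int[P]_t (if W t <= z then 1 else 0) - Phi z|.
have DE z : (`|cdf W z - normal_cdf z|%E = (D z)%:E).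
  by rewrite cdfE normal_cdfE -EFinB abse_EFin.
have D1 z : D z <= 1.
  have F0 : 0 <= \int[P]_t (if W t <= z then 1 else 0).
    by apply: Rintegral_ge0 => t _; case: ifP.
  have F1 : \int[P]_t (if W t <= z then 1 else 0) <= 1.
    by rewrite -lee_fin -cdfE; exact: probability_le1.
  have := Phi_ge0 z; have := Phi_le1 z.
  by rewrite /D ler_norml => h1 h2; apply/andP; split; lra.
have ub : (normal_distance W <= 1%:E)%E.
  by apply: ge_ereal_sup => _ [z _ <-]; rewrite DE lee_fin.
have le z : ((D z)%:E <= normal_distance W)%E.
  by rewrite -DE; apply: ereal_sup_ubound; exists z.
have fin : normal_distance W \is a fin_num.
  rewrite fin_numE; apply/andP; split.
    by apply/eqP => E; have := le 0; rewrite E leeNy_eq.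
  by apply/eqP => E; move: ub; rewrite E leye_eq.
exists (fine (normal_distance W)); split => [|z|B HB].
- by rewrite fineK.
- by rewrite -lee_fin fineK//; exact: le.
- rewrite -lee_fin fineK//; apply: ge_ereal_sup => _ [z _ <-].
  by rewrite DE lee_fin; exact: HB.
Qed.

Lemma abs_momentE (U : {RV P >-> R}) r :
  abs_moment U r = (\int[P]_t (`|U t| `^ r)%:E)%E.
Proof. by rewrite /abs_moment expectation.unlock. Qed.

Lemma measurable_abs_powR (f : T -> R) r : measurable_fun setT f ->
  measurable_fun setT (fun t => `|f t| `^ r).
Proof.
move=> mf; apply: (@measurableT_comp _ _ _ _ _ _ (fun x : R => x `^ r)).
  exact: measurable_powR.
exact: measurableT_comp.
Qed.

Lemma abs_moment_ge0 (U : {RV P >-> R}) r : (0 <= abs_moment U r)%E.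
Proof. by rewrite abs_momentE integral_ge0// => t _; rewrite lee_fin powR_ge0. Qed.

Lemma intg_abs_moment (U : {RV P >-> R}) r :
  (abs_moment U r < +oo)%E -> intg P (fun t => `|U t| `^ r).
Proof.
rewrite abs_momentE => H; apply/integrableP; split.
  by apply/measurable_EFinP; exact: measurable_abs_powR.
under eq_integral do rewrite /= ger0_norm ?powR_ge0//.
exact: H.
Qed.

Lemma abs_moment_fin (U : {RV P >-> R}) r : intg P (fun t => `|U t| `^ r) ->
  abs_moment U r = (\int[P]_t (`|U t| `^ r))%:E.
Proof. by move=> H; rewrite abs_momentE /Rintegral fineK//; exact: integrable_fin_num. Qed.

Lemma intg_powR_le (f : T -> R) r s : measurable_fun setT f -> 0 <= r -> r <= s ->
  intg P (fun t => `|f t| `^ s) -> intg P (fun t => `|f t| `^ r).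
Proof.
move=> mf r0 rs i_s; apply: (@intg_le _ _ _ _ _ (fun t => 1 + `|f t| `^ s)).
- exact: measurable_abs_powR.
- by apply: intgD => //; exact: intg_cst.
- move=> t; rewrite [leLHS]ger0_norm ?powR_ge0// [leRHS]ger0_norm ?addr_ge0 ?powR_ge0//.
  exact: powR_le_add1.
Qed.

End distance.

(** * The theorem *)

Section conclusion.
Context {d : measure_display} {T : measurableType d} {R : realType}.
Variable P : probability T R.

(** Young's inequality [cube_powR_le] at the scale u = theta 2^(-1/p) for which
    theta^p = 2 u^p: it yields E|U|^3 + E|V|^3 <= 2 u^3 = 2^(1 - 3/p) theta^3. *)
Lemma cube_moments_le (U V : T -> R) p theta : 3 <= p -> p <= 4 -> 0 < theta ->
  measurable_fun setT U -> measurable_fun setT V ->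
  intg P (fun t => `|U t| `^ p) -> intg P (fun t => `|V t| `^ p) ->
  \int[P]_t (`|U t| `^ p) + \int[P]_t (`|V t| `^ p) <= theta `^ p ->
  \int[P]_t (`|U t| `^ 3) + \int[P]_t (`|V t| `^ 3) <= 119 / 100 * theta `^ 3.
Proof.
move=> p3 p4 th0 mU mV iU iV Hth; have p0 : 0 < p by lra.
have iU3 : intg P (fun t => `|U t| `^ 3) by exact: (intg_powR_le mU _ p3 iU).
have iV3 : intg P (fun t => `|V t| `^ 3) by exact: (intg_powR_le mV _ p3 iV).
pose w : R := 2 `^ (- p^-1); pose u := theta * w.
have w0 : 0 < w by rewrite powR_gt0.
have u0 : 0 < u by rewrite mulr_gt0.
have up : theta `^ p = 2 * u `^ p.
  rewrite powRM ?ltW// -powRrM mulNr mulVf ?gt_eqF// powR_inv1//.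
  by rewrite mulrCA mulfV ?mulr1.
have young (f : T -> R) : intg P (fun t => `|f t| `^ 3) -> intg P (fun t => `|f t| `^ p) ->
    \int[P]_t (`|f t| `^ 3) * u `^ (p - 3) <=
    3 / p * \int[P]_t (`|f t| `^ p) + (p - 3) / p * u `^ p.
  move=> i3 ip; rewrite mulrC -EZ// -EZ//.
  have iZ := intgZ (3 / p) ip.
  rewrite -[X in _ <= _ + X](Ecst P) -ED//; last exact: intg_cst.
  apply: Ele; first exact: intgZ.
    by apply: intgD => //; exact: intg_cst.
  by move=> t; rewrite mulrC; exact: cube_powR_le.
have up3 : u `^ p = u `^ 3 * u `^ (p - 3).
  by rewrite -powRD ?(gt_eqF u0) ?implybT// addrC subrK.
have H : (\int[P]_t (`|U t| `^ 3) + \int[P]_t (`|V t| `^ 3)) * u `^ (p - 3) <=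
    2 * u `^ 3 * u `^ (p - 3).
  apply: (@le_trans _ _ (3 / p * theta `^ p + 2 * ((p - 3) / p * u `^ p))).
    have h1 := young U iU3 iU; have h2 := young V iV3 iV.
    have h3 : 3 / p * (\int[P]_t (`|U t| `^ p) + \int[P]_t (`|V t| `^ p)) <=
      3 / p * theta `^ p by rewrite ler_wpM2l// divr_ge0// ltW.
    rewrite mulrDl; apply: (le_trans (lerD h1 h2)); rewrite addrACA -mulrDr lerD//.
    by rewrite mulr_natl mulr2n.
  rewrite le_eqVlt; apply/orP; left; apply/eqP; rewrite -(mulrA 2 (u `^ 3)) -up3 up.
  by field; rewrite gt_eqF.
move: H; rewrite ler_pM2r ?powR_gt0// => H; apply: (le_trans H).
have -> : u `^ 3 = theta `^ 3 * w `^ 3 by rewrite powRM// ltW.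
rewrite mulrCA [leRHS]mulrC ler_wpM2l ?powR_ge0//.
exact: two_powR_le.
Qed.

Context {J : finType}.
Variable X : J -> {RV P >-> R}.
Hypothesis mean0 : forall i, ('E_P[X i] = 0)%E.
Hypothesis finite_var : forall i, ('V_P[X i] < +oo)%E.
Hypothesis varW : ('V_P[family_sum X [set: J]%SET] = 1)%E.
Variables A B : J -> {set J}.
Hypothesis subAB : forall i, A i \subset B i.
Hypothesis indepX : forall i, indep_subfamilies X [set i]%SET (~: A i)%SET.
Hypothesis indepA : forall i, indep_subfamilies X (A i) (~: B i)%SET.
Variables p kappa : R.
Hypotheses (p_gt2 : 2 < p) (p_le4 : p <= 4).
Hypothesis card_nbr : forall i, #|neighbours B i|%:R <= kappa.

Let Y i (t : T) := \sum_(j in A i) X j t.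
Let moments := moment_sum P (fun i => X i : T -> R) Y.

Let sX i : sqint P (X i).
Proof. exact: sqint_of_variance. Qed.

Let EX i : \int[P]_t X i t = 0.
Proof. by have := mean0 i; rewrite expectation.unlock /Rintegral => ->. Qed.

Let WE t : family_sum X [set: J]%SET t = \sum_i X i t.
Proof. by rewrite family_sumE; apply: eq_bigl => i; rewrite inE. Qed.

Let EW2 : \int[P]_t ((\sum_i X i t) ^+ 2) = 1.
Proof.
have EW : Rintegral P setT (family_sum X [set: J]%SET) = 0.
  transitivity (\int[P]_t (\sum_i X i t)); first by apply: eq_Rintegral => t _; exact: WE.
  by rewrite Esum ?big1// => i; exact: sqint_intg.
have := varW; rewrite varianceE_Rintegral EW => /(congr1 fine) /= <-.
by rewrite /Rintegral; congr fine; apply: eq_integral => t _; rewrite subr0 WE.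
Qed.

Let sumXY : \sum_i \int[P]_t (X i t * Y i t) = 1.
Proof. exact: (local_sum_XY sX EX indepX EW2). Qed.

Lemma kappa_ge1 : 1 <= kappa.
Proof. exact: (local_kappa_ge1 sX EX subAB indepX card_nbr sumXY). Qed.

Lemma normal_distance_le : exists delta : R,
  normal_distance (family_sum X [set: J]%SET) = delta%:E /\
  ((forall i, intg P (fun t => `|X i t| `^ p)) ->
   (forall i, intg P (fun t => `|Y i t| `^ p)) ->
   (p <= 3 -> delta <= 13 * moments p + 5 / 2 * Num.sqrt (kappa * moments p)) /\
   (3 <= p -> delta <= (109 / 10 + 46 / 5 * kappa) * moments 3 +
      5 / 2 * Num.sqrt (kappa * moments p))).
Proof.
have [delta [dE dP dleast]] := normal_distanceE (family_sum X [set: J]%SET).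
exists delta; split => // iX iY; have k0 : 0 <= kappa := le_trans ler01 kappa_ge1.
have FE z : \int[P]_t (if family_sum X [set: J]%SET t <= z then 1 else 0) =
    \int[P]_t (if \sum_i X i t <= z then 1 else 0).
  by apply: eq_Rintegral => t _; rewrite WE.
have {}dP z : `|\int[P]_t (if \sum_i X i t <= z then 1 else 0) - Phi z| <= delta.
  by rewrite -FE; exact: dP.
have {}dleast b :
    (forall z, `|\int[P]_t (if \sum_i X i t <= z then 1 else 0) - Phi z| <= b) ->
    delta <= b.
  by move=> H; apply: dleast => z; rewrite FE; exact: H.
have sY := sqint_local_sum sX A.
have orth i f := @local_orthogonal _ _ _ _ _ _ sX EX A indepX i f.
have var g := @local_variance_le _ _ _ _ _ _ sX EX A B subAB indepX indepA kappa g card_nbr.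
have mY i : measurable_fun setT (Y i) by exact: sqint_measurable (sY i).
split => [p3|p3].
  exact: (kolmogorov_rough sX sY orth sumXY EW2 var dP dleast k0 p_gt2 p3 iX iY).
apply: (kolmogorov_fine sX sY orth sumXY EW2 var dP dleast k0 p3 p_le4 _ _ iX iY) => i.
  exact: (intg_powR_le _ _ p3 (iX i)).
exact: (intg_powR_le (mY i) _ p3 (iY i)).
Qed.

Let msum_ge0 r : 0 <= moments r.
Proof. exact: moment_sum_ge0. Qed.

Let YE i : (family_sum X (A i) : T -> R) = Y i.
Proof. by apply/funext => t; rewrite family_sumE. Qed.

Lemma abs_moment_sumE r : (forall i, intg P (fun t => `|X i t| `^ r)) ->
  (forall i, intg P (fun t => `|Y i t| `^ r)) ->
  (\sum_(i : J) (abs_moment (X i) r + abs_moment (family_sum X (A i)) r) =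
   (moments r)%:E)%E.
Proof.
move=> iX iY; rewrite -sumEFin; apply: eq_bigr => i _.
rewrite EFinD abs_moment_fin// abs_moment_fin ?YE//.
Qed.

(** When a p-th moment is infinite, so is the right-hand side of the theorem. *)
Lemma abs_moment_sum_pinfty i r :
  abs_moment (X i) r + abs_moment (family_sum X (A i)) r = +oo%E ->
  (\sum_(i : J) (abs_moment (X i) r + abs_moment (family_sum X (A i)) r) = +oo)%E.
Proof.
move=> E; rewrite (bigD1 i)//= E addye//; apply/eqP => H.
have : (0 <= \sum_(j | j != i) (abs_moment (X j) r + abs_moment (family_sum X (A j)) r))%E.
  by apply: sume_ge0 => j _; rewrite adde_ge0 ?abs_moment_ge0.
by rewrite H leeNy_eq.
Qed.

Lemma berry_esseen_moments :
  (normal_distance (family_sum X [set: J]%SET) <=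
    (13 + 11 * kappa)%:E *
      (\sum_(i : J) (abs_moment (X i) (Num.min 3 p)%R
                     + abs_moment (family_sum X (A i)) (Num.min 3 p)%R))
    + (5 / 2)%:E *
      sqrte (kappa%:E * (\sum_(i : J) (abs_moment (X i) p
                                       + abs_moment (family_sum X (A i)) p))))%E.
Proof.
have [delta [-> H]] := normal_distance_le.
have k1 := kappa_ge1; have k0 : 0 < kappa := lt_le_trans ltr01 k1.
have q0 : 0 <= Num.min 3 p by rewrite le_min ler0n ltW// (lt_trans _ p_gt2).
have qp : Num.min 3 p <= p by rewrite ge_min lexx orbT.
have S0 r : (0 <= \sum_(i : J) (abs_moment (X i) r + abs_moment (family_sum X (A i)) r))%E.
  by apply: sume_ge0 => i _; rewrite adde_ge0 ?abs_moment_ge0.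
case: (pselect (forall i, abs_moment (X i) p + abs_moment (family_sum X (A i)) p < +oo)%E)
  => [fin|/existsNP[i /negP inf]]; last first.
  rewrite [X in sqrte (_ * X)](@abs_moment_sum_pinfty i); last first.
    by apply/eqP; rewrite -leye_eq leNgt.
  rewrite gt0_muley ?lte_fin// /= gt0_muley ?lte_fin ?divr_gt0//.
  rewrite addey ?leey//; apply/eqP => E.
  have c0 : (0 <= (13 + 11 * kappa)%:E)%E.
    by rewrite lee_fin addr_ge0// mulr_ge0// ltW.
  by have := mule_ge0 c0 (S0 (Num.min 3 p)); rewrite E leeNy_eq.
have iX i : intg P (fun t => `|X i t| `^ p).
  apply: intg_abs_moment; apply: le_lt_trans (fin i).
  by rewrite leeDl// abs_moment_ge0.
have iY i : intg P (fun t => `|Y i t| `^ p).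
  rewrite -YE; apply: intg_abs_moment; apply: le_lt_trans (fin i).
  by rewrite leeDr// abs_moment_ge0.
have mX i : measurable_fun setT (X i) by exact: sqint_measurable (sX i).
have mY i : measurable_fun setT (Y i).
  exact: (sqint_measurable (sqint_local_sum sX A i)).
rewrite abs_moment_sumE//; last 2 first.
- by move=> i; apply: (intg_powR_le (mX i) q0 qp).
- by move=> i; apply: (intg_powR_le (mY i) q0 qp).
rewrite abs_moment_sumE//= lee_fin.
have [H1 H2] := H iX iY; have [p3|/ltW p3] := leP p 3.
  apply: (le_trans (H1 p3)); rewrite lerD2r ler_wpM2r//.
  by rewrite lerDl mulr_ge0// ltW.
apply: (le_trans (H2 p3)); rewrite lerD2r ler_wpM2r//; lra.
Qed.

Lemma berry_esseen_uniform_moments (theta : R) : 0 < theta ->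
  (forall i, abs_moment (X i) p + abs_moment (family_sum X (A i)) p
             <= (theta `^ p)%:E)%E ->
  (normal_distance (family_sum X [set: J]%SET) <=
    ((13 + 11 * kappa) * #|J|%:R * theta `^ Num.min 3 p
     + 5 / 2 * theta `^ (p / 2) * Num.sqrt (kappa * #|J|%:R))%:E)%E.
Proof.
move=> th0 mom; have [delta [-> H]] := normal_distance_le.
have k1 := kappa_ge1; have k0 : 0 < kappa := lt_le_trans ltr01 k1.
have iX i : intg P (fun t => `|X i t| `^ p).
  apply: intg_abs_moment; apply: le_lt_trans (ltry (theta `^ p)); apply: le_trans (mom i).
  by rewrite leeDl// abs_moment_ge0.
have iY i : intg P (fun t => `|Y i t| `^ p).
  rewrite -YE; apply: intg_abs_moment; apply: le_lt_trans (ltry (theta `^ p)).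
  by apply: le_trans (mom i); rewrite leeDr// abs_moment_ge0.
have mX i : measurable_fun setT (X i) by exact: sqint_measurable (sX i).
have mY i : measurable_fun setT (Y i).
  exact: (sqint_measurable (sqint_local_sum sX A i)).
have momR i : \int[P]_t (`|X i t| `^ p) + \int[P]_t (`|Y i t| `^ p) <= theta `^ p.
  have := mom i; rewrite abs_moment_fin// abs_moment_fin ?YE//.
have sum_le c r : (forall i, \int[P]_t (`|X i t| `^ r) + \int[P]_t (`|Y i t| `^ r) <= c) ->
    moments r <= #|J|%:R * c.
  move=> Hc; rewrite mulr_natl -sumr_const; exact: ler_sum.
have Ep : 5 / 2 * Num.sqrt (kappa * moments p) <=
    5 / 2 * theta `^ (p / 2) * Num.sqrt (kappa * #|J|%:R).
  rewrite -(mulrA (5 / 2)) ler_wpM2l//.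
  rewrite (_ : theta `^ (p / 2) * _ = Num.sqrt (kappa * (#|J|%:R * theta `^ p))).
    by rewrite ler_wsqrtr// ler_wpM2l ?(ltW k0)// sum_le.
  rewrite (_ : theta `^ p = (theta `^ (p / 2)) ^+ 2); last first.
    by rewrite -powR_mulrn ?powR_ge0// -powRrM divfK.
  rewrite [in RHS]mulrA [in RHS]sqrtrM ?(mulr_ge0 (ltW k0))// sqrtr_sqr.
  by rewrite ger0_norm ?powR_ge0// mulrC.
have [H1 H2] := H iX iY; rewrite lee_fin; have [p3|/ltW p3] := leP p 3.
  apply: (le_trans (H1 p3)); apply: lerD => //; rewrite -mulrA.
  apply: ler_pM; rewrite ?sum_le//.
  by rewrite lerDl mulr_ge0// ltW.
apply: (le_trans (H2 p3)); apply: lerD => //.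
apply: (@le_trans _ _ ((109 / 10 + 46 / 5 * kappa) * (#|J|%:R * (119 / 100 * theta `^ 3)))).
  rewrite ler_wpM2l//; first by rewrite addr_ge0// mulr_ge0// ltW.
  by apply: sum_le => i; exact: (cube_moments_le p3 p_le4 th0).
rewrite (_ : _ * _ = (109 / 10 + 46 / 5 * kappa) * (119 / 100) * (#|J|%:R * theta `^ 3));
  last by ring.
rewrite -[leRHS]mulrA ler_wpM2r ?mulr_ge0 ?powR_ge0//; lra.
Qed.

End conclusion.

Unset Implicit Arguments.
Set Strict Implicit.

Local Open Scope ereal_scope.

Theorem theorem2p2
  (d : measure_display) (T : measurableType d) (R : realType)
  (P : probability T R) (J : finType) (X : J -> {RV P >-> R})
  (mean0 : forall i, 'E_P[X i] = 0)
  (finite_var : forall i, 'V_P[X i] < +oo)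
  (varW : 'V_P[family_sum X [set: J]%SET] = 1)
  (A B : J -> {set J})
  (subAB : forall i, A i \subset B i)
  (indepX : forall i, indep_subfamilies X [set i]%SET (~: A i)%SET)
  (indepA : forall i, indep_subfamilies X (A i) (~: B i)%SET)
  (p kappa : R) (p_gt2 : (2 < p)%R) (p_le4 : (p <= 4)%R)
  (card_nbr : forall i, (#|neighbours B i|%:R <= kappa)%R) :
  normal_distance (family_sum X [set: J]%SET) <=
    (13 + 11 * kappa)%:E *
      (\sum_(i : J) (abs_moment (X i) (Num.min 3 p)%R
                     + abs_moment (family_sum X (A i)) (Num.min 3 p)%R))
    + (5 / 2)%:E *
      sqrte (kappa%:E * (\sum_(i : J) (abs_moment (X i) p
                                       + abs_moment (family_sum X (A i)) p)))
  /\
  (forall theta : R, (0 < theta)%R ->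
    (forall i, abs_moment (X i) p + abs_moment (family_sum X (A i)) p
               <= (theta `^ p)%:E) ->
    normal_distance (family_sum X [set: J]%SET) <=
      ((13 + 11 * kappa) * #|J|%:R * theta `^ Num.min 3 p
       + 5 / 2 * theta `^ (p / 2) * Num.sqrt (kappa * #|J|%:R))%:E).
Proof.
split; first exact: (berry_esseen_moments mean0 finite_var varW subAB indepX indepA
  p_gt2 p_le4 card_nbr).
exact: (berry_esseen_uniform_moments mean0 finite_var varW subAB indepX indepA
  p_gt2 p_le4 card_nbr).
Qed.
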